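(* Let $\ell>0$ and $\nu(z)=e^{\ell(z+z^{-1})/2}$ on $\mathbb T$ (in which case the coefficients $\alpha_n$ are real). For $n\in\mathbb N$ put $\sigma_n=(1-\alpha_{n-1}^2)\alpha_n\alpha_{n-2}-\alpha_{n-1}^2$. Then for every $n\in\mathbb N$ (the identities for $G_n,G_{n-1}^*$ being for $z\notin\mathbb T$): $$z^2\Phi_n''+\Big(\frac{\ell}{2}z^2+(2-n)z-\frac{\ell}{2}\Big)\Phi_n'+\Big(-\frac{\ell n}{2}z-\frac{\ell^2}{4}-n-\frac{\ell^2}{4}\sigma_n\Big)\Phi_n=-\frac{\ell}{2}(1-\alpha_{n-1}^2)\alpha_n\Phi_{n-1}^*,$$ $$z^2G_n''+\Big(-\frac{\ell}{2}z^2+(n+2)z+\frac{\ell}{2}\Big)G_n'-\Big(\ell\big(\tfrac n2+1\big)z+\frac{\ell^2}{4}+\frac{\ell^2}{4}\sigma_n\Big)G_n=-\frac{\ell}{2}(1-\alpha_{n-1}^2)\alpha_nG_{n-1}^*,$$ $$z^2(\Phi_{n-1}^* )''+\Big(\frac{\ell}{2}z^2+(2-n)z-\frac{\ell}{2}\Big)(\Phi_{n-1}^* )'-\Big(\ell\big(\tfrac n2-1\big)z+\frac{\ell^2}{4}+\frac{\ell^2}{4}\sigma_n\Big)\Phi_{n-1}^*=-\frac{\ell}{2}\alpha_{n-2}\Phi_n,$$ $$z^2(G_{n-1}^* )''+\Big(-\frac{\ell}{2}z^2+(n+2)z+\frac{\ell}{2}\Big)(G_{n-1}^* )'-\Big(\frac{\ell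 n}{2}z+\frac{\ell^2}{4}-n+\frac{\ell^2}{4}\sigma_n\Big)G_{n-1}^*=-\frac{\ell}{2}\alpha_{n-2}G_n .$$
   Context: $\mathbb N=\{1,2,\dots\}$, $\mathbb T=\{|z|=1\}$ (counterclockwise), $d\mu(z)=\frac{\nu(z)}{\mathrm i z}dz$. $\Phi_n$ is the monic polynomial of degree $n$ with $\int_{\mathbb T}\Phi_n\overline{\Phi_m}\,d\mu=\kappa_n^{-2}\delta_{n,m}$, $\kappa_n>0$; $\Phi_n^*(z)=z^n\overline{\Phi_n(1/\bar z)}$; $\alpha_{n-1}=-\overline{\Phi_n(0)}$ for $n\ge1$ and $\alpha_{-1}=-1$. For $z\notin\mathbb T$, $$G_n(z)=\frac1{2\pi \mathrm i}\int_{\mathbb T}\frac{\Phi_n(t)}{t-z}\frac{\nu(t)}{t^n}dt,\qquad G_{n-1}^*(z)=\frac1{2\pi \mathrm i}\int_{\mathbb T}\frac{\Phi_{n-1}^*(t)}{t-z}\frac{\nu(t)}{t^n}dt .$$ *)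

(* Defs.v *)
From Stdlib Require Import Reals ZArith.
From Coquelicot Require Import Coquelicot.
Open Scope R_scope.
Open Scope C_scope.

Definition Cexp (z : C) : C :=
  RtoC (exp (Re z)) * (cos (Im z), sin (Im z)).

(* Contour integral over the counterclockwise unit circle, parametrised by
   t = exp (i theta), so that dt = i exp (i theta) dtheta. *)
Definition circle_int (f : C -> C) : C :=
  RInt (V := C_R_CompleteNormedModule)
    (fun theta : R =>
       f (Cexp (Ci * RtoC theta)) * (Ci * Cexp (Ci * RtoC theta)))
    0 (2 * PI).

(* Integral against dmu(z) = nu(z) / (i z) dz. *)
Definition mu_int (nu : C -> C) (f : C -> C) : C :=
  circle_int (fun z => f z * (nu z / (Ci * z))).

Definition Cpoly_eval (d : nat) (c : nat -> C) (z : C) : C :=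
  sum_n (G := C_AbelianMonoid) (fun k => c k * z ^ k) d.

Definition is_poly_le (d : nat) (p : C -> C) : Prop :=
  exists c : nat -> C, forall z, p z = Cpoly_eval d c z.

Definition is_monic_poly (d : nat) (p : C -> C) : Prop :=
  exists c : nat -> C, c d = RtoC 1 /\ forall z, p z = Cpoly_eval d c z.

Definition is_monic_OPUC (nu : C -> C) (Phi : nat -> C -> C) : Prop :=
  (forall n, is_monic_poly n (Phi n)) /\
  exists kappa : nat -> R,
    (forall n, (0 < kappa n)%R) /\
    (forall n m,
       mu_int nu (fun z => Phi n z * Cconj (Phi m z)) =
       if Nat.eqb n m then RtoC (/ (kappa n ^ 2))%R else RtoC 0).

(* Phi_n^*(z) = z^n conj (Phi_n (1 / conj z)).  At z = 0 the right-hand side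
   only makes sense as a limit; requiring Phi_n^* to be a polynomial function
   fixes that value. *)
Definition is_reversed (Phi Phis : nat -> C -> C) : Prop :=
  forall n,
    is_poly_le n (Phis n) /\
    forall z, z <> RtoC 0 -> Phis n z = z ^ n * Cconj (Phi n (/ Cconj z)).

(* Indexed by integers k >= -1; values at k < -1 are irrelevant. *)
Definition alpha (Phi : nat -> C -> C) (k : Z) : C :=
  if Z.eqb k (-1) then RtoC (-1)
  else - Cconj (Phi (Z.to_nat (k + 1)) (RtoC 0)).

Definition cauchy_G (nu : C -> C) (Phi : nat -> C -> C) (n : nat) (z : C) : C :=
  / (2 * RtoC PI * Ci) *
  circle_int (fun t => Phi n t / (t - z) * (nu t / t ^ n)).

(* The power of t in the denominator is one more than the index: this is
   G_m^* with m = n - 1. *)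
Definition cauchy_Gs (nu : C -> C) (Phis : nat -> C -> C) (m : nat) (z : C) : C :=
  / (2 * RtoC PI * Ci) *
  circle_int (fun t => Phis m t / (t - z) * (nu t / t ^ (S m))).

Definition nu_exp (ell : R) (z : C) : C :=
  Cexp (RtoC ell * (z + / z) / 2).

Definition sigma_coef (Phi : nat -> C -> C) (n : nat) : C :=
  let a k := alpha Phi (Z.of_nat n + k) in
  (1 - a (-1)%Z ^ 2) * a 0%Z * a (-2)%Z - a (-1)%Z ^ 2.

(* C_derive is a total operator which only looks along the real direction, so
   its values are meaningful only together with complex differentiability. *)
Definition twice_C_derivable (f : C -> C) (z : C) : Prop :=
  ex_derive (K := C_AbsRing) (V := C_NormedModule) f z /\
  ex_derive (K := C_AbsRing) (V := C_NormedModule) (C_derive f) z.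

(* Main.v *)
Require Import Defs.
From Stdlib Require Import Reals ZArith Lra Lia FunctionalExtensionality.
From Coquelicot Require Import Coquelicot.
Open Scope R_scope.
Open Scope C_scope.

(** On the circle [z nu'(z) = (l/2) (z - 1/z) nu(z)], so integration by parts computes all the
    moments of [z Phi_n'] and gives
    [z Phi_n' = n Phi_n + (l/2) (1 - alpha_{n-1}^2) (Phi_{n-1} - alpha_n Phi*_{n-1})].
    Its value at [0] is the discrete Painleve II equation
    [n alpha_{n-1} = - (l/2) (1 - alpha_{n-1}^2) (alpha_n + alpha_{n-2})]. Combined with the Szego
    recurrence and reversal, it becomes a first-order system for [(Phi_n, Phi*_{n-1})]; eliminating
    derivatives with the help of Painleve II gives the two second-order equations. The functions
    [Phi_n nu / t^n] and [Phi*_{n-1} nu / t^n] satisfy on the circle the equations claimed for [G_n]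
    and [G*_{n-1}], and these pass to Cauchy transforms by integration by parts, the boundary term
    being a multiple of a vanishing moment. Throughout, [Phi n 0] stands for [- alpha_{n-1}]. *)

(** * Curves and integrals on the unit circle *)

(** All polynomial identities rest on one uniqueness principle, [OPUC_complete]: a polynomial of
    degree at most d whose moments against z^(-m) vanish for 0 <= m <= d is zero. Realness of the
    coefficients, the Szego recurrence and the formula for z Phi_n' are each proved by computing the
    moments of a difference. The same principle extends identities from z <> 0 to z = 0
    ([OPUC_poly_ext]), which matters because reversal and the cancellation of z^2 only make sense
    off 0. Realness comes from the evenness of the weight in the angle; it turns reversal into the
    plain substitution z -> 1/z, without conjugates. For the Cauchy transforms the boundary term is
    (g - l/2) times the moment of P / z^(n-1), where g is the coefficient of z in the zeroth-order
    term of the equation of P. For P = Phi_n the moment vanishes. For P = Phi*_{n-1} it vanishes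
    when n >= 2; when n = 1 it does not, but then g = l/2. *)

Definition circ (th : R) : C := (cos th, sin th).

(** Stated componentwise, so that each rule below reduces to the real sum, product and quotient
    rules. *)
Definition curve_derive (F : R -> C) (th : R) (l : C) : Prop :=
  is_derive (fun t => Re (F t)) th (Re l) /\
  is_derive (fun t => Im (F t)) th (Im l).

Definition curve_cont (F : R -> C) : Prop :=
  forall th, continuous (fun t => Re (F t)) th /\
             continuous (fun t => Im (F t)) th.

Definition circ_RInt (F : R -> C) : C :=
  RInt (V := C_R_CompleteNormedModule) F 0 (2 * PI).

Lemma C_eq (z w : C) : Re z = Re w -> Im z = Im w -> z = w.
Proof. destruct z, w; simpl; intros; subst; reflexivity. Qed.

Lemma Cexp_circ (th : R) : Cexp (Ci * RtoC th) = circ th.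
Proof.
unfold Cexp, circ.
replace (Re (Ci * RtoC th)) with 0%R by (simpl; ring).
replace (Im (Ci * RtoC th)) with th by (simpl; ring).
rewrite exp_0; apply Cmult_1_l.
Qed.

Lemma Cmod_circ (th : R) : Cmod (circ th) = 1%R.
Proof.
unfold Cmod, circ; cbn [fst snd].
replace (cos th ^ 2 + sin th ^ 2)%R with 1%R by (rewrite <- (sin2_cos2 th); unfold Rsqr; ring).
apply sqrt_1.
Qed.

Lemma circ_nz (th : R) : circ th <> 0.
Proof. apply Cmod_gt_0; rewrite Cmod_circ; lra. Qed.

Lemma circ_conj (th : R) : Cconj (circ th) = / circ th.
Proof.
assert (H : Cconj (circ th) * circ th = 1).
{ apply C_eq; simpl; [rewrite <- (sin2_cos2 th); unfold Rsqr|]; ring. }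
rewrite <- (Cmult_1_l (/ _)), <- H; field; apply circ_nz.
Qed.

Lemma circ_2PI : circ (2 * PI) = circ 0.
Proof. unfold circ; now rewrite cos_2PI, sin_2PI, cos_0, sin_0. Qed.

Lemma curve_cont_const (c : C) : curve_cont (fun _ => c).
Proof. intros th; split; apply continuous_const. Qed.

Lemma curve_cont_circ : curve_cont circ.
Proof.
intros th; split; simpl;
  [apply continuous_cos_comp | apply continuous_sin_comp]; apply continuous_id.
Qed.

Lemma curve_cont_RtoC (f : R -> R) :
  (forall t, continuous f t) -> curve_cont (fun t => RtoC (f t)).
Proof. intros H th; split; simpl; [apply H | apply continuous_const]. Qed.

Lemma curve_cont_plus (F G : R -> C) :
  curve_cont F -> curve_cont G -> curve_cont (fun t => F t + G t).
Proof.
intros HF HG th; destruct (HF th), (HG th); split; simpl;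
  apply (continuous_plus (V := R_NormedModule)); assumption.
Qed.

Lemma curve_cont_opp (F : R -> C) : curve_cont F -> curve_cont (fun t => - F t).
Proof.
intros HF th; destruct (HF th); split; simpl;
  apply (continuous_opp (V := R_NormedModule)); assumption.
Qed.

Lemma curve_cont_minus (F G : R -> C) :
  curve_cont F -> curve_cont G -> curve_cont (fun t => F t - G t).
Proof. intros HF HG; apply curve_cont_plus, curve_cont_opp; assumption. Qed.

Lemma curve_cont_conj (F : R -> C) : curve_cont F -> curve_cont (fun t => Cconj (F t)).
Proof.
intros HF th; destruct (HF th); split; simpl; auto;
  apply (continuous_opp (V := R_NormedModule)); assumption.
Qed.

Lemma curve_cont_mult (F G : R -> C) :
  curve_cont F -> curve_cont G -> curve_cont (fun t => F t * G t).
Proof.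
intros HF HG th; destruct (HF th), (HG th); split; simpl.
- apply (continuous_minus (V := R_NormedModule));
  apply (continuous_mult (K := R_AbsRing)); assumption.
- apply (continuous_plus (V := R_NormedModule));
  apply (continuous_mult (K := R_AbsRing)); assumption.
Qed.

Lemma curve_cont_pow (F : R -> C) (n : nat) :
  curve_cont F -> curve_cont (fun t => F t ^ n).
Proof.
intros HF; induction n; simpl.
- apply curve_cont_const.
- now apply curve_cont_mult.
Qed.

Lemma sum_sq_pos (z : C) : z <> 0 -> (0 < Re z ^ 2 + Im z ^ 2)%R.
Proof.
intros Hz; destruct (Rle_lt_dec (Re z ^ 2 + Im z ^ 2) 0) as [H|H]; auto.
exfalso; apply Hz, C_eq; simpl; nra.
Qed.

Lemma curve_cont_inv (F : R -> C) :
  curve_cont F -> (forall t, F t <> 0) -> curve_cont (fun t => / F t).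
Proof.
intros HF Hnz th; destruct (HF th) as [HR HI]; split; simpl;
  apply continuity_pt_filterlim, continuity_pt_div;
  try (apply continuity_pt_opp);
  try (apply continuity_pt_filterlim; assumption).
all: try (apply continuity_pt_plus; apply continuity_pt_mult;
  try (apply continuity_pt_mult; [|apply continuity_pt_const; intros ? ?; reflexivity]);
  apply continuity_pt_filterlim; assumption).
all: generalize (sum_sq_pos _ (Hnz th)); unfold Re, Im; simpl; lra.
Qed.

Lemma curve_cont_div (F G : R -> C) :
  curve_cont F -> curve_cont G -> (forall t, G t <> 0) ->
  curve_cont (fun t => F t / G t).
Proof. intros HF HG Hnz; apply curve_cont_mult, curve_cont_inv; assumption. Qed.

Lemma curve_cont_continuous (F : R -> C) (th : R) :
  curve_cont F -> continuous (U := C_R_CompleteNormedModule) F th.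
Proof.
intros HF; destruct (HF th) as [HR HI].
apply filterlim_locally; intros eps.
apply filterlim_locally with (eps := eps) in HR.
apply filterlim_locally with (eps := eps) in HI.
generalize (filter_and _ _ HR HI); apply filter_imp.
intros t [H1 H2]; split; assumption.
Qed.

Lemma circ_RInt_pair (F : R -> C) : curve_cont F ->
  circ_RInt F = (RInt (fun t => Re (F t)) 0 (2 * PI), RInt (fun t => Im (F t)) 0 (2 * PI)).
Proof.
intros HF; unfold circ_RInt.
apply (is_RInt_unique (V := C_R_CompleteNormedModule)).
apply (is_RInt_fct_extend_pair (U := R_NormedModule) (V := R_NormedModule));
  apply (RInt_correct (V := R_CompleteNormedModule)); apply (ex_RInt_continuous (V := R_CompleteNormedModule));
  intros z _; apply (HF z).
Qed.

Lemma circ_RInt_ext (F G : R -> C) :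
  (forall t, F t = G t) -> circ_RInt F = circ_RInt G.
Proof. intros H; apply (RInt_ext (V := C_R_CompleteNormedModule)); auto. Qed.

(** The components of a sum, of a complex multiple and of a conjugate are all real combinations of
    this shape, so this one lemma gives the linearity rules of [circ_RInt]. *)
Lemma RInt_lin2 (f g : R -> R) (a b : R) :
  (forall t, continuous f t) -> (forall t, continuous g t) ->
  RInt (fun t => a * f t + b * g t)%R 0 (2 * PI) =
  (a * RInt f 0 (2 * PI) + b * RInt g 0 (2 * PI))%R.
Proof.
intros Hf Hg.
assert (Ef : ex_RInt f 0 (2 * PI)) by (apply (ex_RInt_continuous (V := R_CompleteNormedModule)); auto).
assert (Eg : ex_RInt g 0 (2 * PI)) by (apply (ex_RInt_continuous (V := R_CompleteNormedModule)); auto).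
apply is_RInt_unique.
apply (is_RInt_plus (V := R_NormedModule));
apply (is_RInt_scal (V := R_NormedModule)); now apply (RInt_correct (V := R_CompleteNormedModule)).
Qed.

Lemma circ_RInt_plus (F G : R -> C) : curve_cont F -> curve_cont G ->
  circ_RInt (fun t => F t + G t) = circ_RInt F + circ_RInt G.
Proof.
intros HF HG; rewrite !circ_RInt_pair; auto using curve_cont_plus.
apply C_eq; simpl.
- transitivity (1 * RInt (fun t => Re (F t)) 0 (2 * PI) + 1 * RInt (fun t => Re (G t)) 0 (2 * PI))%R.
  2: unfold Re; lra.
  rewrite <- RInt_lin2; [|intros t; apply HF|intros t; apply HG].
  apply RInt_ext; intros; unfold Re; lra.
- transitivity (1 * RInt (fun t => Im (F t)) 0 (2 * PI) + 1 * RInt (fun t => Im (G t)) 0 (2 * PI))%R.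
  2: unfold Im; lra.
  rewrite <- RInt_lin2; [|intros t; apply HF|intros t; apply HG].
  apply RInt_ext; intros; unfold Im; lra.
Qed.

Lemma circ_RInt_scal (c : C) (F : R -> C) : curve_cont F ->
  circ_RInt (fun t => c * F t) = c * circ_RInt F.
Proof.
intros HF; rewrite !circ_RInt_pair; auto using curve_cont_mult, curve_cont_const.
apply C_eq; simpl.
- transitivity (Re c * RInt (fun t => Re (F t)) 0 (2 * PI) + (- Im c) * RInt (fun t => Im (F t)) 0 (2 * PI))%R.
  2: unfold Re, Im; lra.
  rewrite <- RInt_lin2; [|intros t; apply HF|intros t; apply HF].
  apply RInt_ext; intros; unfold Re, Im; lra.
- transitivity (Re c * RInt (fun t => Im (F t)) 0 (2 * PI) + Im c * RInt (fun t => Re (F t)) 0 (2 * PI))%R.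
  2: unfold Re, Im; lra.
  rewrite <- RInt_lin2; [|intros t; apply HF|intros t; apply HF].
  apply RInt_ext; intros; unfold Re, Im; lra.
Qed.

Lemma circ_RInt_conj (F : R -> C) : curve_cont F ->
  circ_RInt (fun t => Cconj (F t)) = Cconj (circ_RInt F).
Proof.
intros HF; rewrite !circ_RInt_pair; auto using curve_cont_conj.
unfold Cconj; simpl; f_equal.
transitivity ((-1) * RInt (fun t => Im (F t)) 0 (2 * PI) + 0 * RInt (fun t => Im (F t)) 0 (2 * PI))%R.
2: unfold Im; lra.
rewrite <- RInt_lin2; [|intros t; apply HF|intros t; apply HF].
apply RInt_ext; intros; unfold Im; lra.
Qed.

(** On the unit circle the substitution t -> 2 PI - t is z -> 1/z, which preserves the weight; this
    is the source of the symmetry [moment_reflect]. *)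
Lemma RInt_reflect (f : R -> R) : (forall t, continuous f t) ->
  RInt (fun t => f (2 * PI - t)%R) 0 (2 * PI) = RInt f 0 (2 * PI).
Proof.
intros Hf.
assert (Hex : forall a b, ex_RInt f a b).
{ intros a b; apply (ex_RInt_continuous (V := R_CompleteNormedModule)); auto. }
assert (H := is_RInt_comp_lin (V := R_NormedModule) f (-1) (2 * PI) 0 (2 * PI)
  (RInt f (2 * PI) 0)).
replace (-1 * 0 + 2 * PI)%R with (2 * PI)%R in H by ring.
replace (-1 * (2 * PI) + 2 * PI)%R with 0%R in H by ring.
specialize (H (RInt_correct f _ _ (Hex _ _))).
(* The affine substitution has slope -1 and exchanges the bounds; the factor -1 undoes both sign
   changes. *)
apply (is_RInt_scal (V := R_NormedModule) _ _ _ (-1)) in H.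
apply is_RInt_unique.
replace (RInt f 0 (2 * PI)) with (scal (-1)%R (RInt f (2 * PI) 0)).
2:{ rewrite <- (opp_RInt_swap (V := R_CompleteNormedModule) f 0) by auto.
    unfold scal, opp; simpl; unfold mult; simpl; ring. }
eapply is_RInt_ext; [|exact H].
intros t _; unfold scal; simpl; unfold mult; simpl.
replace (2 * PI - t)%R with (-1 * t + 2 * PI)%R by ring; ring.
Qed.

Lemma curve_cont_reflect (F : R -> C) :
  curve_cont F -> curve_cont (fun t => F (2 * PI - t)%R).
Proof.
intros HF th; destruct (HF (2 * PI - th)%R) as [HR HI].
assert (H : continuous (fun t => 2 * PI - t)%R th).
{ apply (continuous_minus (V := R_NormedModule));
  [apply continuous_const | apply continuous_id]. }
split.
- exact (continuous_comp (fun t => 2 * PI - t)%R (fun t => Re (F t)) th H HR).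
- exact (continuous_comp (fun t => 2 * PI - t)%R (fun t => Im (F t)) th H HI).
Qed.

Lemma circ_RInt_reflect (F : R -> C) : curve_cont F ->
  circ_RInt (fun t => F (2 * PI - t)%R) = circ_RInt F.
Proof.
intros HF; rewrite !circ_RInt_pair; auto using curve_cont_reflect.
f_equal.
- apply (RInt_reflect (fun t => Re (F t))); intros t; apply HF.
- apply (RInt_reflect (fun t => Im (F t))); intros t; apply HF.
Qed.

Lemma circ_RInt_derive (F F1 : R -> C) :
  (forall t, curve_derive F t (F1 t)) -> curve_cont F1 ->
  circ_RInt F1 = F (2 * PI)%R - F 0%R.
Proof.
intros HF H1; rewrite circ_RInt_pair by assumption.
apply C_eq; simpl; apply is_RInt_unique.
- apply (is_RInt_derive (V := R_CompleteNormedModule) (fun t => Re (F t)));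
  intros t _; [apply HF | apply H1].
- apply (is_RInt_derive (V := R_CompleteNormedModule) (fun t => Im (F t)));
  intros t _; [apply HF | apply H1].
Qed.

(** * Differentiation along curves *)

Lemma curve_derive_cont (F F1 : R -> C) :
  (forall t, curve_derive F t (F1 t)) -> curve_cont F.
Proof.
intros H th; destruct (H th); split;
  apply (ex_derive_continuous (V := R_NormedModule)); eexists; eassumption.
Qed.

Lemma curve_derive_eq (F : R -> C) th (l l' : C) :
  curve_derive F th l -> l = l' -> curve_derive F th l'.
Proof. now intros H <-. Qed.

Lemma curve_derive_const (c : C) th : curve_derive (fun _ => c) th 0.
Proof. split; apply (is_derive_const (V := R_NormedModule)). Qed.

Lemma curve_derive_circ th : curve_derive circ th (Ci * circ th).
Proof.
split; simpl; [|]; auto_derive; auto; ring.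
Qed.

Lemma curve_derive_RtoC (f : R -> R) th l :
  is_derive f th l -> curve_derive (fun t => RtoC (f t)) th (RtoC l).
Proof. intros H; split; simpl; [exact H | apply (is_derive_const (V := R_NormedModule))]. Qed.

Lemma curve_derive_plus (F G : R -> C) th f g :
  curve_derive F th f -> curve_derive G th g ->
  curve_derive (fun t => F t + G t) th (f + g).
Proof.
intros [] []; split; simpl; apply (is_derive_plus (V := R_NormedModule)); assumption.
Qed.

Lemma curve_derive_minus (F G : R -> C) th f g :
  curve_derive F th f -> curve_derive G th g ->
  curve_derive (fun t => F t - G t) th (f - g).
Proof.
intros [] []; split; simpl; apply (is_derive_minus (V := R_NormedModule)); assumption.
Qed.

Lemma is_derive_val (f : R -> R) x l l' : is_derive f x l -> l = l' -> is_derive f x l'.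
Proof. now intros H <-. Qed.

Lemma curve_derive_mult (F G : R -> C) th f g :
  curve_derive F th f -> curve_derive G th g ->
  curve_derive (fun t => F t * G t) th (f * G th + F th * g).
Proof.
intros [FR FI] [GR GI]; split; simpl.
- eapply is_derive_val.
  + apply (is_derive_minus (V := R_NormedModule));
    [apply (Derive.is_derive_mult _ _ _ _ _ FR GR) | apply (Derive.is_derive_mult _ _ _ _ _ FI GI)].
  + unfold minus, plus, opp, Re, Im; simpl; ring.
- eapply is_derive_val.
  + apply (is_derive_plus (V := R_NormedModule));
    [apply (Derive.is_derive_mult _ _ _ _ _ FR GI) | apply (Derive.is_derive_mult _ _ _ _ _ FI GR)].
  + unfold minus, plus, opp, Re, Im; simpl; ring.
Qed.

Lemma curve_derive_inv (F : R -> C) th f :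
  curve_derive F th f -> F th <> 0 ->
  curve_derive (fun t => / F t) th (- f / F th ^ 2).
Proof.
intros [FR FI] Hnz.
assert (Hp := sum_sq_pos _ Hnz).
assert (Hd : is_derive (fun t => Re (F t) ^ 2 + Im (F t) ^ 2)%R th
  (2 * Re (F th) * Re f + 2 * Im (F th) * Im f)%R).
{ eapply is_derive_val.
  - apply (is_derive_plus (V := R_NormedModule));
      apply is_derive_pow; eassumption.
  - unfold plus; simpl; ring. }
(* The complex quotient by [F th ^ 2] has the real denominator |F^2|^2 = |F|^4, whose nonvanishing
   [field] will ask for. *)
assert (H2 : (Re (F th ^ 2) ^ 2 + Im (F th ^ 2) ^ 2 <> 0)%R).
{ replace (Re (F th ^ 2) ^ 2 + Im (F th ^ 2) ^ 2)%R
    with ((Re (F th) ^ 2 + Im (F th) ^ 2) ^ 2)%R by (unfold Re, Im; simpl; ring).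
  apply pow_nonzero; lra. }
simpl in H2; split; simpl.
- eapply is_derive_val; [apply (is_derive_div _ _ _ _ _ FR Hd); lra | ].
  unfold Re, Im in *; simpl in *; field.
  split; intros H; first [lra | apply H2; rewrite <- H; ring].
- eapply is_derive_val; [apply (is_derive_div _ _ _ _ _
    (is_derive_opp (V := R_NormedModule) _ _ _ FI) Hd); lra | ].
  unfold Re, Im, opp in *; simpl in *; field.
  split; intros H; first [lra | apply H2; rewrite <- H; ring].
Qed.

(** * Cauchy transforms *)

Lemma Cmod_circ_RInt_le (F : R -> C) (M : R) :
  curve_cont F -> (forall t, (0 <= t <= 2 * PI)%R -> (Cmod (F t) <= M)%R) ->
  (Cmod (circ_RInt F) <= 2 * PI * M)%R.
Proof.
intros HF HM.
assert (Hpi := PI_RGT_0).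
assert (H0 : (0 <= 2 * PI)%R) by lra.
rewrite Cmod_norm.
apply (norm_RInt_le (V := C_R_NormedModule) F (fun _ => M) 0 (2 * PI) _ _ H0).
- intros t Ht; specialize (HM t Ht); rewrite Cmod_norm in HM; exact HM.
- apply (RInt_correct (V := C_R_CompleteNormedModule)).
  apply ex_RInt_continuous; intros; now apply curve_cont_continuous.
- replace (2 * PI * M)%R with (scal (2 * PI - 0)%R M).
  2: unfold scal; simpl; unfold mult; simpl; ring.
  apply (is_RInt_const (V := R_NormedModule)).
Qed.

Lemma curve_cont_bounded (F : R -> C) : curve_cont F ->
  exists M : R, (0 <= M)%R /\ forall t, (0 <= t <= 2 * PI)%R -> (Cmod (F t) <= M)%R.
Proof.
intros HF.
destruct (bounded_continuity (V := C_R_NormedModule) F 0 (2 * PI)) as [M HM].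
{ intros; now apply curve_cont_continuous. }
exists M; split.
- apply Rle_trans with (1 := norm_ge_0 (V := C_R_NormedModule) (F 0%R)), Rlt_le, HM.
  generalize PI_RGT_0; lra.
- intros t Ht; rewrite Cmod_norm; apply Rlt_le, HM, Ht.
Qed.

(** In both applications, the Cauchy kernel and 1/z, the first-order remainder is an explicit
    fraction with numerator h^2, so a quadratic bound is the convenient criterion. *)
Lemma is_C_derive_quadratic (f : C -> C) (z l : C) (M d : R) :
  (0 < d)%R -> (0 <= M)%R ->
  (forall h, (Cmod h < d)%R -> (Cmod (f (z + h) - f z - h * l)%C <= M * Cmod h ^ 2)%R) ->
  is_derive (K := C_AbsRing) (V := C_NormedModule) f z l.
Proof.
intros Hd HM H; split; [apply (is_linear_scal_l (K := C_AbsRing) (V := C_NormedModule)) | ].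
intros x Hx; apply (is_filter_lim_locally_unique (V := AbsRing_NormedModule C_AbsRing)) in Hx; subst x.
intros eps.
(* Dividing by M + 1 rather than M covers M = 0. *)
assert (He : (0 < Rmin d (eps / (M + 1)))%R).
{ apply Rmin_pos; auto; apply Rdiv_lt_0_compat; [apply eps | lra]. }
exists (mkposreal _ He); intros y Hy; change C in y.
change (Cmod (y - z)%C < Rmin d (eps / (M + 1)))%R in Hy.
change (Cmod (f y - f z - (y - z) * l)%C <= eps * Cmod (y - z)%C)%R.
specialize (H (y - z)).
replace (z + (y - z)) with y in H by ring.
assert (H1 := Rmin_l d (eps / (M + 1))); assert (H2 := Rmin_r d (eps / (M + 1))).
eapply Rle_trans; [apply H; lra | ].
assert (H3 := Cmod_ge_0 (y - z)).
replace (M * Cmod (y - z)%C ^ 2)%R with (M * Cmod (y - z)%C * Cmod (y - z)%C)%R by ring.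
apply Rmult_le_compat_r; auto.
apply Rle_trans with (M * (eps / (M + 1)))%R.
{ apply Rmult_le_compat_l; lra. }
assert (Hep := cond_pos eps).
apply Rle_trans with ((M + 1) * (eps / (M + 1)))%R; [| right; field; lra].
apply Rmult_le_compat_r; [ | lra].
apply Rlt_le, Rdiv_lt_0_compat; lra.
Qed.

Lemma Cmult_cancel_r (r x y : C) : x * r = y * r -> r <> 0 -> x = y.
Proof.
intros H Hr; rewrite <- (Cmult_1_r x), <- (Cmult_1_r y), <- (Cinv_r r Hr).
now rewrite !Cmult_assoc, H.
Qed.

Lemma is_C_derive_scal (k : C) (f : C -> C) (z l : C) :
  is_derive (K := C_AbsRing) (V := C_NormedModule) f z l ->
  is_derive (K := C_AbsRing) (V := C_NormedModule) (fun w => k * f w) z (k * l).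
Proof.
intros H; eapply filterdiff_ext_lin.
- apply (filterdiff_scal_r_fct (K := C_AbsRing) (U := AbsRing_NormedModule C_AbsRing) (V := C_NormedModule) k f); [ apply Cmult_comm | exact H].
- intros y; change (k * (y * l) = y * (k * l)); ring.
Qed.

(** The density is a function of the angle because it is only ever differentiated along the circle.
    The factor 1/(2 pi i) is left out; [Cauchy_transf_ode] restores it as the constant [k]. *)
Definition Cauchy_transf (F : R -> C) (z : C) : C :=
  circ_RInt (fun t => F t / (circ t - z) * (Ci * circ t)).

Lemma Cmod_circ_minus (t : R) (z : C) : (Rabs (1 - Cmod z) <= Cmod (circ t - z)%C)%R.
Proof.
rewrite <- (Cmod_circ t); apply Rabs_le; split.
- generalize (Cmod_triangle (circ t) (z - circ t)).
  replace (circ t + (z - circ t)) with z by ring.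
  replace (z - circ t) with (- (circ t - z)) by ring; rewrite Cmod_opp; lra.
- generalize (Cmod_triangle (circ t - z) z).
  replace (circ t - z + z) with (circ t) by ring; lra.
Qed.

Lemma circ_minus_nz (t : R) (z : C) : Cmod z <> 1%R -> circ t - z <> 0.
Proof.
intros Hz H; apply Hz.
replace z with (circ t - (circ t - z)) by ring; rewrite H.
unfold Cminus; rewrite Copp_0, Cplus_0_r; apply Cmod_circ.
Qed.

Lemma Cauchy_kernel_cont (F : R -> C) (z : C) : curve_cont F -> Cmod z <> 1%R ->
  curve_cont (fun t => F t / (circ t - z) * (Ci * circ t)).
Proof.
intros HF Hz; apply curve_cont_mult.
- apply curve_cont_div; auto.
  + apply curve_cont_minus; [apply curve_cont_circ | apply curve_cont_const].
  + intros t; now apply circ_minus_nz.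
- apply curve_cont_mult; [apply curve_cont_const | apply curve_cont_circ].
Qed.

(** Differentiation under the integral sign, made quantitative: the remainder of the kernel is
    exactly h^2 / ((t - z)^2 (t - z - h)). *)
Lemma Cauchy_transf_derive_sq (F : R -> C) (z : C) : curve_cont F -> Cmod z <> 1%R ->
  is_derive (K := C_AbsRing) (V := C_NormedModule) (Cauchy_transf F) z
    (circ_RInt (fun t => F t / (circ t - z) ^ 2 * (Ci * circ t))).
Proof.
intros HF Hz.
destruct (curve_cont_bounded F HF) as [M [HM0 HM]].
set (d := Rabs (1 - Cmod z)).
assert (Hd : (0 < d)%R) by (apply Rabs_pos_lt; intros H; apply Hz; lra).
assert (HK2 : curve_cont (fun t => F t / (circ t - z) ^ 2 * (Ci * circ t))).
{ apply curve_cont_mult.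
  - apply curve_cont_div; auto.
    + apply curve_cont_pow, curve_cont_minus; [apply curve_cont_circ | apply curve_cont_const].
    + intros t; now apply Cpow_nz, circ_minus_nz.
  - apply curve_cont_mult; [apply curve_cont_const | apply curve_cont_circ]. }
assert (Hd3 : (0 < 2 / d ^ 3)%R) by (apply Rdiv_lt_0_compat; [lra | now apply pow_lt]).
(* [d] is the distance from z to the circle, and |h| < d/2 keeps z + h at distance at least d/2.
   Hence the kernel remainder is at most |h|^2 / (d^2 (d/2)); 2 PI is the length of the circle and
   [M] bounds [F]. *)
apply is_C_derive_quadratic with (M := (2 * PI * (M * (2 / d ^ 3)))%R) (d := (d / 2)%R); [lra | | ].
{ apply Rmult_le_pos; [generalize PI_RGT_0; lra | apply Rmult_le_pos; lra]. }
intros h Hh.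
assert (Hzh : (d / 2 <= Rabs (1 - Cmod (z + h)%C))%R).
{ assert (H1 := Cmod_triangle z h).
  assert (H2 := Cmod_triangle (z + h) (- h)); rewrite Cmod_opp in H2.
  replace (z + h + - h) with z in H2 by ring.
  unfold d in *; revert Hh; unfold Rabs; repeat destruct Rcase_abs; lra. }
assert (Hzh1 : Cmod (z + h) <> 1%R).
{ intros H; rewrite H, Rminus_diag, Rabs_R0 in Hzh; lra. }
set (K := fun t => F t * (h ^ 2 / ((circ t - z) ^ 2 * (circ t - (z + h)))) * (Ci * circ t)).
assert (HE : Cauchy_transf F (z + h) - Cauchy_transf F z -
  h * circ_RInt (fun t => F t / (circ t - z) ^ 2 * (Ci * circ t)) = circ_RInt K).
{ unfold Cauchy_transf.
  transitivity (circ_RInt (fun t => F t / (circ t - (z + h)) * (Ci * circ t)) +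
    ((-(1)) * circ_RInt (fun t => F t / (circ t - z) * (Ci * circ t)) +
    (- h) * circ_RInt (fun t => F t / (circ t - z) ^ 2 * (Ci * circ t)))); [ring | ].
  rewrite <- !circ_RInt_scal, <- !circ_RInt_plus;
    auto 7 using Cauchy_kernel_cont, curve_cont_plus, curve_cont_mult, curve_cont_const.
  apply circ_RInt_ext; intros t; unfold K; field; split; now apply circ_minus_nz. }
rewrite HE, Rmult_assoc; apply Cmod_circ_RInt_le.
{ unfold K; apply curve_cont_mult.
  - apply curve_cont_mult; auto; apply curve_cont_div; [apply curve_cont_const | | ].
    + apply curve_cont_mult; [apply curve_cont_pow | ];
       (apply curve_cont_minus; [apply curve_cont_circ | apply curve_cont_const]).
    + intros t; apply Cmult_neq_0; [apply Cpow_nz | ]; now apply circ_minus_nz.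
  - apply curve_cont_mult; [apply curve_cont_const | apply curve_cont_circ]. }
intros t Ht; unfold K.
rewrite !Cmod_mult, Cmod_circ.
replace (Cmod Ci) with 1%R.
2:{ unfold Cmod, Ci; simpl; replace (0 * (0 * 1) + 1 * (1 * 1))%R with 1%R by ring; now rewrite sqrt_1. }
rewrite Cmod_div by (apply Cmult_neq_0; [apply Cpow_nz | ]; now apply circ_minus_nz).
rewrite !Rmult_1_r, !Rmult_assoc.
apply Rmult_le_compat; [apply Cmod_ge_0 | | now apply HM | ].
{ apply Rmult_le_pos; [apply Cmod_ge_0 | ].
  apply Rlt_le, Rinv_0_lt_compat, Cmod_gt_0, Cmult_neq_0; [apply Cpow_nz | ]; now apply circ_minus_nz. }
rewrite Cmod_mult, !Cmod_pow.
replace (2 / d ^ 3 * Cmod h ^ 2)%R with (Cmod h ^ 2 * / (d ^ 2 * (d / 2)))%R.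
2:{ field; lra. }
apply Rmult_le_compat_l; [apply pow2_ge_0 | ].
apply Rinv_le_contravar.
{ apply Rmult_lt_0_compat; [now apply pow_lt | lra]. }
apply Rmult_le_compat; [apply pow2_ge_0 | lra | | ].
- apply pow_incr; split; [lra | apply Cmod_circ_minus].
- eapply Rle_trans; [exact Hzh | apply Cmod_circ_minus].
Qed.

(* Integrating [F' / (t - z)] by parts along the circle moves the derivative from the kernel to [F]. *)
Lemma Cauchy_transf_derive (F F1 : R -> C) (z : C) :
  (forall t, curve_derive F t (Ci * circ t * F1 t)) -> curve_cont F1 ->
  F (2 * PI)%R = F 0%R -> Cmod z <> 1%R ->
  is_derive (K := C_AbsRing) (V := C_NormedModule) (Cauchy_transf F) z (Cauchy_transf F1 z).
Proof.
intros HF H1 Hper Hz.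
assert (HFc := curve_derive_cont _ _ HF).
replace (Cauchy_transf F1 z) with (circ_RInt (fun t => F t / (circ t - z) ^ 2 * (Ci * circ t))).
{ now apply Cauchy_transf_derive_sq. }
assert (HK2 : curve_cont (fun t => F t / (circ t - z) ^ 2 * (Ci * circ t))).
{ apply curve_cont_mult.
  - apply curve_cont_div; auto.
    + apply curve_cont_pow, curve_cont_minus; [apply curve_cont_circ | apply curve_cont_const].
    + intros t; now apply Cpow_nz, circ_minus_nz.
  - apply curve_cont_mult; [apply curve_cont_const | apply curve_cont_circ]. }
set (K1 := fun t => F1 t / (circ t - z) * (Ci * circ t)).
set (K2 := fun t => F t / (circ t - z) ^ 2 * (Ci * circ t)).
assert (HK1 : curve_cont K1) by now apply Cauchy_kernel_cont.
assert (H : circ_RInt (fun t => K1 t + (-(1)) * K2 t) = F (2 * PI)%R / (circ (2 * PI) - z) - F 0%R / (circ 0 - z)).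
{ apply (circ_RInt_derive (fun t => F t / (circ t - z))).
  - intros t; eapply curve_derive_eq.
    + apply curve_derive_mult; [apply HF | apply curve_derive_inv; [ | now apply circ_minus_nz]].
      apply curve_derive_minus; [apply curve_derive_circ | apply curve_derive_const].
    + unfold K1, K2; field; now apply circ_minus_nz.
  - apply curve_cont_plus; auto; apply curve_cont_mult; auto; apply curve_cont_const. }
rewrite circ_RInt_plus, circ_RInt_scal, Hper, circ_2PI in H; auto.
2:{ apply curve_cont_mult; auto; apply curve_cont_const. }
unfold Cauchy_transf; fold K1 K2.
replace (circ_RInt K2) with (circ_RInt K1 - (circ_RInt K1 + - (1) * circ_RInt K2)) by ring.
rewrite H; ring.
Qed.

(** Differentiating a second time requires the formula for the first derivative on a whole
    neighbourhood of z. *)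
Lemma locally_off_circle (z : C) : Cmod z <> 1%R ->
  locally (T := AbsRing_UniformSpace C_AbsRing) z (fun w => Cmod w <> 1%R).
Proof.
intros Hz; assert (Hd : (0 < Rabs (1 - Cmod z))%R) by (apply Rabs_pos_lt; intros H; apply Hz; lra).
exists (mkposreal _ Hd); intros w Hw; change C in w; change (Cmod (w - z)%C < Rabs (1 - Cmod z))%R in Hw.
intros H1.
assert (H2 := Cmod_triangle (w - z) z).
replace (w - z + z) with w in H2 by ring.
assert (H3 := Cmod_triangle w (- (w - z))); rewrite Cmod_opp in H3.
replace (w + - (w - z)) with z in H3 by ring.
revert Hw; unfold Rabs; destruct Rcase_abs; lra.
Qed.

(** [F1] and [F2] are the derivatives of [F] with respect to t = circ th, hence the factor
    [Ci * circ t]. The obstruction to transferring the equation is kept as a product, because in the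
    application sometimes the moment vanishes and sometimes the coefficient d - a. *)
Lemma Cauchy_transf_ode (F F1 F2 K : R -> C) (a b c d e q : C) :
  (forall t, curve_derive F t (Ci * circ t * F1 t)) ->
  (forall t, curve_derive F1 t (Ci * circ t * F2 t)) ->
  curve_cont F2 -> curve_cont K ->
  F (2 * PI)%R = F 0%R -> F1 (2 * PI)%R = F1 0%R ->
  (forall t, circ t ^ 2 * F2 t + (a * circ t ^ 2 + b * circ t + c) * F1 t
     + (d * circ t + e) * F t = q * K t) ->
  (d - a) * circ_RInt (fun t => F t * (Ci * circ t)) = 0 ->
  forall (G : C -> C) (k z : C), (forall w, G w = k * Cauchy_transf F w) -> Cmod z <> 1%R ->
  twice_C_derivable G z /\
  z ^ 2 * C_derive (C_derive G) z + (a * z ^ 2 + b * z + c) * C_derive G z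
    + (d * z + e) * G z = q * (k * Cauchy_transf K z).
Proof.
intros HF HF1 H2 HK P0 P1 Hode Hm G k z HG Hz.
assert (C0 := curve_derive_cont _ _ HF); assert (C1 := curve_derive_cont _ _ HF1).
assert (D0 : forall w, Cmod w <> 1%R ->
  is_derive (K := C_AbsRing) (V := C_NormedModule) G w (k * Cauchy_transf F1 w)).
{ intros w Hw; apply (is_derive_ext (V := C_NormedModule) (fun w => k * Cauchy_transf F w)).
  { intros; symmetry; apply HG. }
  apply is_C_derive_scal, Cauchy_transf_derive; assumption. }
assert (D1 : forall w, Cmod w <> 1%R ->
  is_derive (K := C_AbsRing) (V := C_NormedModule) (C_derive G) w (k * Cauchy_transf F2 w)).
{ intros w Hw; apply (is_derive_ext_loc (V := C_NormedModule) (fun w => k * Cauchy_transf F1 w)).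
  - generalize (locally_off_circle w Hw); apply filter_imp; intros v Hv.
    symmetry; apply is_C_derive_unique, D0, Hv.
  - apply is_C_derive_scal, Cauchy_transf_derive; assumption. }
split; [split; eexists; [apply D0 | apply D1]; exact Hz | ].
rewrite (is_C_derive_unique _ _ _ (D0 z Hz)), (is_C_derive_unique _ _ _ (D1 z Hz)), HG.
unfold Cauchy_transf.
(* Expanding the coefficients around [t] instead of [z], the ODE on the circle removes the
   Cauchy kernel; what is left is an exact derivative plus a multiple of the zeroth moment. *)
set (S := fun t => - (1) * ((circ t + z) * F1 t - F t + (a * ((circ t + z) * F t) + b * F t))).
set (S1 := fun t => - (1) * (Ci * circ t * ((circ t + z) * F2 t + (a * (circ t + z) + b) * F1 t + a * F t))).
assert (Hcc : curve_cont circ) by apply curve_cont_circ.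
assert (HS1 : curve_cont S1) by (unfold S1; auto 10 using curve_cont_mult, curve_cont_plus, curve_cont_const).
assert (HS : circ_RInt S1 = 0).
{ rewrite (circ_RInt_derive S S1); [unfold S; rewrite P0, P1, circ_2PI; ring | | assumption].
  intros t.
  assert (Hz1 : curve_derive (fun t => circ t + z) t (Ci * circ t + 0)).
  { apply curve_derive_plus; [apply curve_derive_circ | apply curve_derive_const]. }
  eapply curve_derive_eq.
  - apply curve_derive_mult; [apply curve_derive_const | ].
    apply curve_derive_plus; [apply curve_derive_minus; [ | apply HF] | apply curve_derive_plus].
    + apply curve_derive_mult; [exact Hz1 | apply HF1].
    + apply curve_derive_mult; [apply curve_derive_const | ].
      apply curve_derive_mult; [exact Hz1 | apply HF].
    + apply curve_derive_mult; [apply curve_derive_const | apply HF].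
  - unfold S1; ring. }
set (k0 := fun t => F t / (circ t - z) * (Ci * circ t)).
set (k1 := fun t => F1 t / (circ t - z) * (Ci * circ t)).
set (k2 := fun t => F2 t / (circ t - z) * (Ci * circ t)).
set (kK := fun t => K t / (circ t - z) * (Ci * circ t)).
assert (E0 : curve_cont k0) by now apply Cauchy_kernel_cont.
assert (E1 : curve_cont k1) by now apply Cauchy_kernel_cont.
assert (E2 : curve_cont k2) by now apply Cauchy_kernel_cont.
assert (EK : curve_cont kK) by now apply Cauchy_kernel_cont.
assert (HR : z ^ 2 * circ_RInt k2 + ((a * z ^ 2 + b * z + c) * circ_RInt k1
    + ((d * z + e) * circ_RInt k0 + - q * circ_RInt kK))
  = circ_RInt S1 + - (d - a) * circ_RInt (fun t => F t * (Ci * circ t))).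
{ rewrite <- !circ_RInt_scal, <- !circ_RInt_plus;
    auto 10 using curve_cont_plus, curve_cont_mult, curve_cont_const.
  apply circ_RInt_ext; intros t; unfold k0, k1, k2, kK, S1.
  (* Pointwise identity: t^2 - z^2 = (t + z)(t - z), so each difference between a coefficient at t
     and at z is divisible by the denominator of the kernel. *)
  apply (Cmult_cancel_r (circ t - z)); [ | now apply circ_minus_nz].
  transitivity (Ci * circ t * (z ^ 2 * F2 t + (a * z ^ 2 + b * z + c) * F1 t + (d * z + e) * F t
    - q * K t)); [field; now apply circ_minus_nz | ].
  rewrite <- Hode; ring. }
rewrite HS in HR.
replace (- (d - a) * circ_RInt (fun t => F t * (Ci * circ t)))
  with (- ((d - a) * circ_RInt (fun t => F t * (Ci * circ t)))) in HR by ring.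
rewrite Hm in HR.
transitivity (k * (z ^ 2 * circ_RInt k2 + ((a * z ^ 2 + b * z + c) * circ_RInt k1
    + ((d * z + e) * circ_RInt k0 + - q * circ_RInt kK))) + q * (k * circ_RInt kK)); [ring | ].
rewrite HR; ring.
Qed.

(** * Complex derivatives and polynomials *)

(* [C_NormedModule] and [AbsRing_NormedModule C_AbsRing] have the same norm but
   different (equivalent) uniform structures. *)
Lemma is_C_derive_AbsRing (f : C -> C) (z l : C) :
  is_derive (K := C_AbsRing) (V := C_NormedModule) f z l <->
  is_derive (K := C_AbsRing) (V := AbsRing_NormedModule C_AbsRing) f z l.
Proof.
split; intros [_ H]; (split; [apply is_linear_scal_l | ]);
  intros x Hx eps; exact (H x Hx eps).
Qed.

Lemma is_C_derive_mult (f g : C -> C) (z df dg : C) :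
  is_derive (K := C_AbsRing) (V := C_NormedModule) f z df ->
  is_derive (K := C_AbsRing) (V := C_NormedModule) g z dg ->
  is_derive (K := C_AbsRing) (V := C_NormedModule) (fun w => f w * g w) z (df * g z + f z * dg).
Proof.
rewrite !is_C_derive_AbsRing; intros Hf Hg.
exact (is_derive_mult (K := C_AbsRing) f g z df dg Hf Hg Cmult_comm).
Qed.

Lemma is_C_derive_plus (f g : C -> C) (z df dg : C) :
  is_derive (K := C_AbsRing) (V := C_NormedModule) f z df ->
  is_derive (K := C_AbsRing) (V := C_NormedModule) g z dg ->
  is_derive (K := C_AbsRing) (V := C_NormedModule) (fun w => f w + g w) z (df + dg).
Proof. apply (is_derive_plus (K := C_AbsRing) (V := C_NormedModule)). Qed.

Lemma is_C_derive_const (c z : C) :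
  is_derive (K := C_AbsRing) (V := C_NormedModule) (fun _ => c) z (RtoC 0).
Proof. apply (is_derive_const (K := C_AbsRing) (V := C_NormedModule)). Qed.

Lemma is_C_derive_id (z : C) :
  is_derive (K := C_AbsRing) (V := C_NormedModule) (fun w => w) z (RtoC 1).
Proof. apply is_C_derive_AbsRing; exact (is_derive_id (K := C_AbsRing) z). Qed.

Lemma is_C_derive_comp (f g : C -> C) (z df dg : C) :
  is_derive (K := C_AbsRing) (V := C_NormedModule) f (g z) df ->
  is_derive (K := C_AbsRing) (V := C_NormedModule) g z dg ->
  is_derive (K := C_AbsRing) (V := C_NormedModule) (fun w => f (g w)) z (dg * df).
Proof.
intros Hf Hg; apply is_C_derive_AbsRing in Hg.
exact (is_derive_comp (K := C_AbsRing) (V := C_NormedModule) f g z df dg Hf Hg).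
Qed.

Lemma is_C_derive_eq (f : C -> C) (z l l' : C) :
  is_derive (K := C_AbsRing) (V := C_NormedModule) f z l -> l = l' ->
  is_derive (K := C_AbsRing) (V := C_NormedModule) f z l'.
Proof. now intros H <-. Qed.

Lemma is_C_derive_pow (n : nat) (z : C) :
  is_derive (K := C_AbsRing) (V := C_NormedModule) (fun w => w ^ S n) z
    (RtoC (INR (S n)) * z ^ n).
Proof.
induction n.
- apply (is_derive_ext (V := C_NormedModule) (fun w => w)).
  + intros; now rewrite Cpow_1_r.
  + eapply is_C_derive_eq; [apply is_C_derive_id | simpl; ring].
- eapply is_C_derive_eq; [apply (is_C_derive_mult _ _ _ _ _ (is_C_derive_id z) IHn) | ].
  rewrite (S_INR (S n)), RtoC_plus; simpl (z ^ _); ring.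
Qed.

Lemma is_C_derive_inv (z : C) : z <> 0 ->
  is_derive (K := C_AbsRing) (V := C_NormedModule) (fun w => / w) z (- / z ^ 2).
Proof.
intros Hz; assert (Hp := proj1 (Cmod_gt_0 z) Hz).
(* The remainder equals h^2 / (z^2 (z + h)), and |h| < |z|/2 gives |z + h| >= |z|/2; hence the
   constant 2/|z|^3. *)
apply is_C_derive_quadratic with (M := (2 / Cmod z ^ 3)%R) (d := (Cmod z / 2)%R); [lra | | ].
{ apply Rlt_le, Rdiv_lt_0_compat; [lra | now apply pow_lt]. }
intros h Hh.
assert (H1 : (Cmod z / 2 <= Cmod (z + h)%C)%R).
{ assert (H := Cmod_triangle (z + h) (- h)); rewrite Cmod_opp in H.
  replace (z + h + - h) with z in H by ring; lra. }
assert (Hzh : z + h <> 0) by (apply Cmod_gt_0; lra).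
replace (/ (z + h) - / z - h * - / z ^ 2) with (h ^ 2 / (z ^ 2 * (z + h))) by (field; auto).
rewrite Cmod_div by (apply Cmult_neq_0; auto; now apply Cpow_nz).
rewrite Cmod_mult, !Cmod_pow.
replace (2 / Cmod z ^ 3 * Cmod h ^ 2)%R with (Cmod h ^ 2 * / (Cmod z ^ 2 * (Cmod z / 2)))%R by (field; lra).
apply Rmult_le_compat_l; [apply pow2_ge_0 | ].
apply Rinv_le_contravar.
- apply Rmult_lt_0_compat; [now apply pow_lt | lra].
- apply Rmult_le_compat_l; auto; apply pow2_ge_0.
Qed.

(** * Polynomial functions of bounded degree *)

Lemma Cpoly_eval_S (d : nat) (c : nat -> C) (z : C) :
  Cpoly_eval (S d) c z = Cpoly_eval d c z + c (S d) * z ^ S d.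
Proof. unfold Cpoly_eval; now rewrite sum_Sn. Qed.

Lemma Cpoly_eval_0 (c : nat -> C) (z : C) : Cpoly_eval 0 c z = c 0%nat.
Proof. unfold Cpoly_eval; rewrite sum_O; simpl; apply Cmult_1_r. Qed.

Lemma Cpoly_eval_ext (d : nat) (c c' : nat -> C) (z : C) :
  (forall k, (k <= d)%nat -> c k = c' k) -> Cpoly_eval d c z = Cpoly_eval d c' z.
Proof. intros H; apply sum_n_ext_loc; intros k Hk; now rewrite H. Qed.

Lemma is_poly_le_ext (d : nat) (p q : C -> C) :
  (forall z, p z = q z) -> is_poly_le d p -> is_poly_le d q.
Proof. intros H [c Hc]; exists c; intros z; rewrite <- H; apply Hc. Qed.

Lemma is_poly_le_const (c : C) : is_poly_le 0 (fun _ => c).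
Proof. exists (fun _ => c); intros z; symmetry; apply Cpoly_eval_0. Qed.

Lemma is_poly_le_0_inv (p : C -> C) : is_poly_le 0 p -> exists c, forall z, p z = c.
Proof. intros [c Hc]; exists (c 0%nat); intros z; rewrite Hc; apply Cpoly_eval_0. Qed.

Lemma is_poly_le_S_inv (d : nat) (p : C -> C) : is_poly_le (S d) p ->
  exists r c, is_poly_le d r /\ forall z, p z = r z + c * z ^ S d.
Proof.
intros [c Hc]; exists (Cpoly_eval d c), (c (S d)); split.
- now exists c.
- intros z; rewrite Hc; apply Cpoly_eval_S.
Qed.

Lemma is_poly_le_S (d : nat) (r : C -> C) (c : C) : is_poly_le d r ->
  is_poly_le (S d) (fun z => r z + c * z ^ S d).
Proof.
intros [a Ha]; exists (fun k => if Nat.leb k d then a k else c); intros z.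
rewrite Cpoly_eval_S, Ha, (proj2 (Nat.leb_gt (S d) d)) by lia; f_equal.
apply Cpoly_eval_ext; intros k Hk; now rewrite (proj2 (Nat.leb_le k d)).
Qed.

Lemma is_poly_le_le (d d' : nat) (p : C -> C) :
  (d <= d')%nat -> is_poly_le d p -> is_poly_le d' p.
Proof.
induction 1 as [ | d' _ IH]; auto; intros Hp.
apply (is_poly_le_ext _ (fun z => p z + 0 * z ^ S d')); [intros; ring | ].
apply is_poly_le_S; auto.
Qed.

Lemma is_poly_le_plus (d : nat) (p q : C -> C) :
  is_poly_le d p -> is_poly_le d q -> is_poly_le d (fun z => p z + q z).
Proof.
intros [a Ha] [b Hb]; exists (fun k => a k + b k); intros z; rewrite Ha, Hb.
clear Ha Hb; induction d; [rewrite !Cpoly_eval_0 | rewrite !Cpoly_eval_S, <- IHd]; ring.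
Qed.

Lemma is_poly_le_scal (d : nat) (c : C) (p : C -> C) :
  is_poly_le d p -> is_poly_le d (fun z => c * p z).
Proof.
intros [a Ha]; exists (fun k => c * a k); intros z; rewrite Ha.
clear Ha; induction d; [rewrite !Cpoly_eval_0 | rewrite !Cpoly_eval_S, <- IHd]; ring.
Qed.

Lemma is_poly_le_minus (d : nat) (p q : C -> C) :
  is_poly_le d p -> is_poly_le d q -> is_poly_le d (fun z => p z - q z).
Proof.
intros Hp Hq; apply (is_poly_le_ext _ (fun z => p z + - (1) * q z)); [intros; ring | ].
now apply is_poly_le_plus; [ | apply is_poly_le_scal].
Qed.

Lemma is_poly_le_mulX (d : nat) (p : C -> C) :
  is_poly_le d p -> is_poly_le (S d) (fun z => z * p z).
Proof.
revert p; induction d; intros p Hp.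
- destruct (is_poly_le_0_inv _ Hp) as [c Hc].
  apply (is_poly_le_ext _ (fun z => 0 + c * z ^ 1)); [intros; rewrite Hc; simpl; ring | ].
  apply is_poly_le_S, is_poly_le_const.
- destruct (is_poly_le_S_inv _ _ Hp) as [r [c [Hr Hc]]].
  apply (is_poly_le_ext _ (fun z => z * r z + c * z ^ S (S d))); [intros; rewrite Hc; simpl; ring | ].
  apply is_poly_le_S, IHd, Hr.
Qed.

Lemma is_poly_le_conj (d : nat) (p : C -> C) :
  is_poly_le d p -> is_poly_le d (fun z => Cconj (p (Cconj z))).
Proof.
intros [c Hc]; exists (fun k => Cconj (c k)); intros z; rewrite Hc; clear Hc.
induction d; [now rewrite !Cpoly_eval_0 | ].
rewrite !Cpoly_eval_S, <- IHd, Cplus_conj, Cmult_conj, Cpow_conj, Cconj_conj; reflexivity.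
Qed.

Lemma is_poly_le_pow (d k : nat) : (k <= d)%nat -> is_poly_le d (fun z => z ^ k).
Proof.
intros H; apply (is_poly_le_le k); auto; clear H.
induction k; [exact (is_poly_le_const 1) | apply (is_poly_le_mulX _ _ IHk)].
Qed.

Lemma is_poly_le_monic (n : nat) (p : C -> C) : is_monic_poly n p -> is_poly_le n p.
Proof. intros [c [_ Hc]]; now exists c. Qed.

Lemma is_monic_poly_0 (p : C -> C) : is_monic_poly 0 p -> forall z, p z = 1.
Proof. intros [c [H1 Hc]] z; now rewrite Hc, Cpoly_eval_0. Qed.

Lemma is_monic_poly_S (d : nat) (p : C -> C) : is_monic_poly (S d) p ->
  exists r, is_poly_le d r /\ forall z, p z = r z + z ^ S d.
Proof.
intros [c [H1 Hc]]; exists (Cpoly_eval d c); split.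
- now exists c.
- intros z; rewrite Hc, Cpoly_eval_S, H1; ring.
Qed.

(** Forgetting the degree makes the class closed under products; enough for continuity,
    differentiability and extension to 0. *)
Definition is_poly (p : C -> C) : Prop := exists d, is_poly_le d p.

Lemma is_poly_of_le (d : nat) (p : C -> C) : is_poly_le d p -> is_poly p.
Proof. now exists d. Qed.

Lemma is_poly_const (c : C) : is_poly (fun _ => c).
Proof. exists 0%nat; apply is_poly_le_const. Qed.

Lemma is_poly_id : is_poly (fun z => z).
Proof.
exists 1%nat; apply (is_poly_le_ext _ (fun z => z ^ 1)).
- intros; apply Cpow_1_r.
- now apply is_poly_le_pow.
Qed.

Lemma is_poly_plus (p q : C -> C) : is_poly p -> is_poly q -> is_poly (fun z => p z + q z).
Proof.
intros [d Hd] [e He]; exists (max d e).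
apply is_poly_le_plus; eapply is_poly_le_le; try eassumption; lia.
Qed.

Lemma is_poly_mult (p q : C -> C) : is_poly p -> is_poly q -> is_poly (fun z => p z * q z).
Proof.
intros [d Hd] Hq; revert p Hd.
assert (Hpow : forall k, is_poly (fun z => z ^ k * q z)).
{ induction k as [ | k [e He]].
  - destruct Hq as [e He]; exists e; revert He; apply is_poly_le_ext; intros; simpl; ring.
  - exists (S e); apply is_poly_le_mulX in He; revert He; apply is_poly_le_ext; intros; simpl; ring. }
assert (Hscal : forall c r, is_poly r -> is_poly (fun z => c * r z)).
{ intros c r [e He]; exists e; now apply is_poly_le_scal. }
induction d; intros p Hp.
- destruct (is_poly_le_0_inv _ Hp) as [c Hc].
  destruct (Hscal c q Hq) as [e He]; exists e; revert He; apply is_poly_le_ext.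
  intros; now rewrite Hc.
- destruct (is_poly_le_S_inv _ _ Hp) as [r [c [Hr Hc]]].
  destruct (is_poly_plus _ _ (IHd _ Hr) (Hscal c _ (Hpow (S d)))) as [e He].
  exists e; revert He; apply is_poly_le_ext; intros; rewrite Hc; ring.
Qed.

Lemma is_poly_opp (p : C -> C) : is_poly p -> is_poly (fun z => - p z).
Proof.
intros [d Hd]; exists d; apply (is_poly_le_scal _ (- (1))) in Hd; revert Hd.
apply is_poly_le_ext; intros; ring.
Qed.

Lemma is_poly_minus (p q : C -> C) : is_poly p -> is_poly q -> is_poly (fun z => p z - q z).
Proof. intros Hp Hq; apply is_poly_plus, is_poly_opp; assumption. Qed.

Lemma is_poly_pow (p : C -> C) (n : nat) : is_poly p -> is_poly (fun z => p z ^ n).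
Proof. intros Hp; induction n; [exact (is_poly_const 1) | now apply is_poly_mult]. Qed.

Lemma curve_derive_circ_pow (n : nat) (th : R) :
  curve_derive (fun t => circ t ^ S n) th
    (Ci * circ th * (RtoC (INR (S n)) * circ th ^ n)).
Proof.
induction n.
- eapply curve_derive_eq; [apply curve_derive_mult; [apply curve_derive_circ | apply curve_derive_const] | ].
  simpl; ring.
- eapply curve_derive_eq; [apply (curve_derive_mult circ _ _ _ _ (curve_derive_circ th) IHn) | ].
  rewrite (S_INR (S n)), RtoC_plus; simpl (_ ^ _); ring.
Qed.

(** One explicit derivative serves for the complex derivative and for the derivative along the
    circle, so the properties are proved together. The degree bound on z p' is d, not d + 1, which
    [OPUC_derive_poly] relies on. *)
Lemma is_poly_le_derive (d : nat) (p : C -> C) : is_poly_le d p ->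
  is_poly_le d (fun z => z * C_derive p z) /\ is_poly_le d (C_derive p) /\
  (forall z, is_derive (K := C_AbsRing) (V := C_NormedModule) p z (C_derive p z)) /\
  (forall th, curve_derive (fun t => p (circ t)) th (Ci * circ th * C_derive p (circ th))).
Proof.
intros Hp.
(* The induction builds an explicit [p']; uniqueness of the derivative identifies it with
   [C_derive p] only at the end. *)
assert (H : exists p', is_poly_le d (fun z => z * p' z) /\ is_poly_le d p' /\
  (forall z, is_derive (K := C_AbsRing) (V := C_NormedModule) p z (p' z)) /\
  (forall th, curve_derive (fun t => p (circ t)) th (Ci * circ th * p' (circ th)))).
{ revert p Hp; induction d; intros p Hp.
  - destruct (is_poly_le_0_inv _ Hp) as [c Hc].
    replace p with (fun _ : C => c) by (apply functional_extensionality; auto).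
    exists (fun _ => 0); split; [ | split; [apply is_poly_le_const | split]].
    + apply (is_poly_le_ext _ (fun _ => 0)); [intros; ring | apply is_poly_le_const].
    + intros z; apply is_C_derive_const.
    + intros th; eapply curve_derive_eq; [apply curve_derive_const | ring].
  - destruct (is_poly_le_S_inv _ _ Hp) as [r [c [Hr Hc]]].
    replace p with (fun z => r z + c * z ^ S d) by (apply functional_extensionality; auto).
    destruct (IHd r Hr) as [r' [H1 [H2 [H3 H4]]]].
    exists (fun z => r' z + c * (RtoC (INR (S d)) * z ^ d)).
    split; [ | split; [ | split]].
    + apply (is_poly_le_ext _ (fun z => z * r' z + (c * RtoC (INR (S d))) * z ^ S d)).
      { intros z; simpl (z ^ _); ring. }
      now apply is_poly_le_S.
    + apply is_poly_le_plus; [now apply (is_poly_le_le d); auto | ].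
      apply is_poly_le_scal, is_poly_le_scal, is_poly_le_pow; lia.
    + intros z; apply is_C_derive_plus; [apply H3 | ].
      apply is_C_derive_scal, is_C_derive_pow.
    + intros th; eapply curve_derive_eq.
      * apply curve_derive_plus; [apply H4 | ].
        apply curve_derive_mult; [apply curve_derive_const | apply curve_derive_circ_pow].
      * cbv beta; generalize (circ th ^ S d) (circ th ^ d) (RtoC (INR (S d))); intros; ring. }
destruct H as [p' [H1 [H2 [H3 H4]]]].
replace (C_derive p) with p'; auto.
apply functional_extensionality; intros z; symmetry; apply is_C_derive_unique, H3.
Qed.

(** * Moments of the weight *)

Definition circ_cont (f : C -> C) : Prop := curve_cont (fun t => f (circ t)).

Definition weight (ell : R) (t : R) : C := RtoC (exp (ell * cos t)).

(** Integration against mu: dz/(iz) is dth on the circle, and there (z + 1/z)/2 = cos th, so nu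
    becomes the positive function [weight]. *)
Definition moment (ell : R) (f : C -> C) : C :=
  circ_RInt (fun t => f (circ t) * weight ell t).

Lemma nu_exp_circ (ell t : R) : nu_exp ell (circ t) = weight ell t.
Proof.
unfold nu_exp, weight; rewrite <- circ_conj.
replace (RtoC ell * (circ t + Cconj (circ t)) / 2) with (RtoC (ell * cos t)).
- unfold Cexp; simpl; rewrite cos_0, sin_0.
  apply C_eq; simpl; ring.
- replace (circ t + Cconj (circ t)) with (2 * RtoC (cos t)) by (apply C_eq; simpl; ring).
  rewrite RtoC_mult; field.
Qed.

Lemma curve_cont_weight (ell : R) : curve_cont (weight ell).
Proof.
apply curve_cont_RtoC; intros t.
apply (ex_derive_continuous (V := R_NormedModule)); auto_derive; auto.
Qed.

(** The factor multiplying the weight is nu'/nu, and [Ci * circ t] converts d/dt into the derivative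
    in the angle. *)
Lemma curve_derive_weight (ell t : R) :
  curve_derive (weight ell) t
    (Ci * circ t * ((RtoC ell / 2 - RtoC ell / (2 * circ t ^ 2)) * weight ell t)).
Proof.
eapply curve_derive_eq.
- apply curve_derive_RtoC.
  instantiate (1 := (exp (ell * cos t) * (ell * - sin t))%R); auto_derive; auto; ring.
- replace (Ci * circ t * ((RtoC ell / 2 - RtoC ell / (2 * circ t ^ 2)) * weight ell t))
    with (Ci * RtoC ell * (circ t - / circ t) / 2 * weight ell t).
  2:{ field; apply circ_nz. }
  rewrite <- circ_conj.
  replace (circ t - Cconj (circ t)) with (2 * Ci * RtoC (sin t)) by (apply C_eq; simpl; ring).
  unfold weight; rewrite !RtoC_mult, RtoC_opp.
  transitivity (RtoC (exp (ell * cos t)) * (Ci * Ci * RtoC ell * RtoC (sin t))).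
  + replace (Ci * Ci) with (- (1)) by (apply C_eq; simpl; ring); ring.
  + field.
Qed.

Lemma circ_cont_const (c : C) : circ_cont (fun _ => c).
Proof. apply curve_cont_const. Qed.

Lemma circ_cont_id : circ_cont (fun z => z).
Proof. apply curve_cont_circ. Qed.

Lemma circ_cont_plus (f g : C -> C) :
  circ_cont f -> circ_cont g -> circ_cont (fun z => f z + g z).
Proof. apply curve_cont_plus. Qed.

Lemma circ_cont_minus (f g : C -> C) :
  circ_cont f -> circ_cont g -> circ_cont (fun z => f z - g z).
Proof. apply curve_cont_minus. Qed.

Lemma circ_cont_mult (f g : C -> C) :
  circ_cont f -> circ_cont g -> circ_cont (fun z => f z * g z).
Proof. apply curve_cont_mult. Qed.

Lemma circ_cont_conj (f : C -> C) : circ_cont f -> circ_cont (fun z => Cconj (f z)).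
Proof. apply curve_cont_conj. Qed.

Lemma circ_cont_pow (f : C -> C) (n : nat) : circ_cont f -> circ_cont (fun z => f z ^ n).
Proof. apply curve_cont_pow. Qed.

Lemma circ_cont_div_pow (f : C -> C) (n : nat) :
  circ_cont f -> circ_cont (fun z => f z / z ^ n).
Proof.
intros Hf; apply curve_cont_div; auto.
- apply curve_cont_pow, curve_cont_circ.
- intros; apply Cpow_nz, circ_nz.
Qed.

Lemma circ_cont_poly (p : C -> C) : is_poly p -> circ_cont p.
Proof.
intros [d Hp]; apply (curve_derive_cont _ _ (proj2 (proj2 (proj2 (is_poly_le_derive d p Hp))))).
Qed.

Lemma circ_reflect (t : R) : circ (2 * PI - t) = / circ t.
Proof.
rewrite <- circ_conj; unfold circ, Cconj; simpl.
rewrite cos_minus, sin_minus, cos_2PI, sin_2PI; f_equal; ring.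
Qed.

Lemma circ_cont_reflect (f : C -> C) : circ_cont f -> circ_cont (fun z => f (/ z)).
Proof.
intros Hf; unfold circ_cont.
replace (fun t => f (/ circ t)) with (fun t => f (circ (2 * PI - t))).
- apply (curve_cont_reflect (fun t => f (circ t))), Hf.
- apply functional_extensionality; intros; now rewrite circ_reflect.
Qed.

Lemma moment_cont (ell : R) (f : C -> C) :
  circ_cont f -> curve_cont (fun t => f (circ t) * weight ell t).
Proof. intros Hf; apply curve_cont_mult; [exact Hf | apply curve_cont_weight]. Qed.

(** The two hypotheses on z are all that the algebra on the circle uses: inverses exist, and
    conjugation is inversion. *)
Lemma moment_ext (ell : R) (f g : C -> C) :
  (forall z : C, z <> 0 -> Cconj z = / z -> f z = g z) -> moment ell f = moment ell g.
Proof.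
intros H; apply circ_RInt_ext; intros t; cbv beta; rewrite (H (circ t)); auto using circ_nz, circ_conj.
Qed.

Lemma moment_plus (ell : R) (f g : C -> C) : circ_cont f -> circ_cont g ->
  moment ell (fun z => f z + g z) = moment ell f + moment ell g.
Proof.
intros Hf Hg; unfold moment.
rewrite <- circ_RInt_plus by now apply moment_cont.
apply circ_RInt_ext; intros; ring.
Qed.

Lemma moment_scal (ell : R) (c : C) (f : C -> C) : circ_cont f ->
  moment ell (fun z => c * f z) = c * moment ell f.
Proof.
intros Hf; unfold moment.
rewrite <- circ_RInt_scal by now apply moment_cont.
apply circ_RInt_ext; intros; ring.
Qed.

Lemma moment_minus (ell : R) (f g : C -> C) : circ_cont f -> circ_cont g ->
  moment ell (fun z => f z - g z) = moment ell f - moment ell g.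
Proof.
intros Hf Hg.
transitivity (moment ell (fun z => f z + (- (1)) * g z)).
- apply moment_ext; intros; ring.
- rewrite moment_plus, moment_scal; auto; [ring | ].
  apply circ_cont_mult; auto; apply circ_cont_const.
Qed.

Lemma moment_conj (ell : R) (f : C -> C) : circ_cont f ->
  moment ell (fun z => Cconj (f z)) = Cconj (moment ell f).
Proof.
intros Hf; unfold moment; rewrite <- circ_RInt_conj by now apply moment_cont.
apply circ_RInt_ext; intros t; cbv beta; rewrite Cmult_conj; f_equal.
unfold weight; apply C_eq; simpl; ring.
Qed.

Lemma moment_reflect (ell : R) (f : C -> C) : circ_cont f ->
  moment ell (fun z => f (/ z)) = moment ell f.
Proof.
intros Hf; unfold moment.
rewrite <- (circ_RInt_reflect (fun t => f (circ t) * weight ell t)) by now apply moment_cont.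
apply circ_RInt_ext; intros t; cbv beta; rewrite circ_reflect; f_equal.
unfold weight; now rewrite cos_minus, cos_2PI, sin_2PI, Rmult_1_l, Rmult_0_l, Rplus_0_r.
Qed.

Lemma mu_int_moment (ell : R) (f : C -> C) : mu_int (nu_exp ell) f = moment ell f.
Proof.
apply circ_RInt_ext; intros t; cbv beta; rewrite Cexp_circ, nu_exp_circ.
field; split; [apply circ_nz | intros H; apply (f_equal Im) in H; simpl in H; lra].
Qed.

Lemma curve_derive_circ_inv_pow (m : nat) (th : R) :
  curve_derive (fun t => / circ t ^ m) th
    (Ci * circ th * (- RtoC (INR m) / circ th ^ S m)).
Proof.
assert (Hz := circ_nz th).
destruct m as [ | m].
- eapply curve_derive_eq; [simpl; apply curve_derive_const | simpl; field; auto].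
- eapply curve_derive_eq; [apply curve_derive_inv; [apply curve_derive_circ_pow | now apply Cpow_nz] | ].
  assert (Hp := Cpow_nz (circ th) m Hz).
  cbn [Cpow]; set (w := circ th ^ m) in *; set (N := RtoC (INR (S m))); field; auto.
Qed.

(* Since [z d/dz nu = (ell/2)(z - 1/z) nu], this is integration by parts along the circle. *)
Lemma moment_parts (ell : R) (p : C -> C) (m : nat) : is_poly p ->
  moment ell (fun z => z * C_derive p z / z ^ m) =
  RtoC (INR m) * moment ell (fun z => p z / z ^ m)
  - RtoC ell / 2 * moment ell (fun z => z * p z / z ^ m)
  + RtoC ell / 2 * moment ell (fun z => p z / z ^ S m).
Proof.
intros [d Hp]; destruct (is_poly_le_derive d p Hp) as [_ [Hd [_ Hc]]].
assert (Cp := circ_cont_poly p (ex_intro _ d Hp)).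
assert (Cd := circ_cont_poly _ (ex_intro _ d Hd)).
set (F := fun z => z * C_derive p z / z ^ m + ((- RtoC (INR m)) * (p z / z ^ m)
   + (RtoC ell / 2 * (z * p z / z ^ m) + - (RtoC ell / 2) * (p z / z ^ S m)))).
assert (Cid := circ_cont_id).
assert (HF : Ci * moment ell F = 0).
{ unfold moment; rewrite <- circ_RInt_scal.
  2:{ apply moment_cont; unfold F;
      auto 10 using circ_cont_plus, circ_cont_mult, circ_cont_div_pow, circ_cont_const. }
  rewrite (circ_RInt_derive (fun t => p (circ t) * / circ t ^ m * weight ell t)).
  - rewrite circ_2PI; unfold weight; rewrite cos_2PI, cos_0; ring.
  - intros t; eapply curve_derive_eq.
    + apply curve_derive_mult; [apply curve_derive_mult | apply curve_derive_weight].
      * apply Hc.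
      * apply curve_derive_circ_inv_pow.
    + unfold F; cbn [Cpow]; assert (Hz := circ_nz t); assert (Hw := Cpow_nz _ m Hz).
      set (w := circ t ^ m) in *; set (N := RtoC (INR m)); field; auto.
  - apply curve_cont_mult; [apply curve_cont_const | apply moment_cont].
    unfold F; auto 10 using circ_cont_plus, circ_cont_mult, circ_cont_div_pow, circ_cont_const. }
assert (HF0 : moment ell F = 0).
{ apply (Cmult_cancel_r Ci); [rewrite Cmult_comm, HF; ring | ].
  intros H; apply (f_equal Im) in H; simpl in H; lra. }
unfold F in HF0; rewrite !moment_plus, !moment_scal in HF0;
  auto 10 using circ_cont_plus, circ_cont_mult, circ_cont_div_pow, circ_cont_const.
rewrite <- Cplus_0_r, <- HF0; ring.
Qed.

(** * Orthogonality *)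

Ltac circ_cont_tac :=
  repeat match goal with
  | H : circ_cont ?f |- circ_cont ?f => exact H
  | |- circ_cont (fun _ => ?c) => apply circ_cont_const
  | |- circ_cont (fun z => z) => apply circ_cont_id
  | |- circ_cont (fun z => _ / z ^ _) => apply circ_cont_div_pow
  | |- circ_cont (fun z => _ + _) => apply circ_cont_plus
  | |- circ_cont (fun z => _ - _) => apply circ_cont_minus
  | |- circ_cont (fun z => Cconj _) => apply circ_cont_conj
  | |- circ_cont (fun z => _ * _) => apply circ_cont_mult
  | |- circ_cont (fun z => z ^ _) => apply circ_cont_pow
  end;
  try solve [assumption | apply circ_cont_poly; eauto using is_poly_of_le].

Lemma Cconj_RtoC (x : R) : Cconj (RtoC x) = RtoC x.
Proof. apply C_eq; simpl; ring. Qed.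

Lemma Cinv_nz (z : C) : z <> 0 -> / z <> 0.
Proof.
intros Hz H; assert (H1 := Cinv_r z Hz); rewrite H, Cmult_0_r in H1.
apply RtoC_inj in H1; lra.
Qed.

Lemma Cinv_invol (z : C) : z <> 0 -> / / z = z.
Proof. intros Hz; field; auto. Qed.

Lemma OPUC_is_poly_le (nu : C -> C) (Phi : nat -> C -> C) (n : nat) :
  is_monic_OPUC nu Phi -> is_poly_le n (Phi n).
Proof. intros [H _]; apply is_poly_le_monic, H. Qed.

Lemma OPUC_is_poly (nu : C -> C) (Phi : nat -> C -> C) (n : nat) :
  is_monic_OPUC nu Phi -> is_poly (Phi n).
Proof. intros H; eapply is_poly_of_le, OPUC_is_poly_le, H. Qed.

Lemma OPUC_ortho (ell : R) (Phi : nat -> C -> C) (n m : nat) :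
  is_monic_OPUC (nu_exp ell) Phi -> n <> m ->
  moment ell (fun z => Phi n z * Cconj (Phi m z)) = 0.
Proof.
intros [_ [kappa [_ H]]] Hnm; specialize (H n m).
now rewrite mu_int_moment, (proj2 (Nat.eqb_neq n m) Hnm) in H.
Qed.

Lemma OPUC_norm (ell : R) (Phi : nat -> C -> C) (n : nat) :
  is_monic_OPUC (nu_exp ell) Phi ->
  moment ell (fun z => Phi n z * Cconj (Phi n z)) <> 0.
Proof.
intros [_ [kappa [Hk H]]]; specialize (H n n).
rewrite mu_int_moment, Nat.eqb_refl in H; rewrite H; intros H0.
apply RtoC_inj in H0; specialize (Hk n).
assert (0 < / (kappa n ^ 2))%R by now apply Rinv_0_lt_compat, pow_lt.
lra.
Qed.

(** The inductive step of expanding a polynomial in a basis of monic polynomials, used with [Phi] as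
    the basis. *)
Lemma poly_split_monic (d : nat) (p Q : C -> C) : is_poly_le (S d) p ->
  is_monic_poly (S d) Q ->
  exists r c, is_poly_le d r /\ forall z, p z = r z + c * Q z.
Proof.
intros Hp HQ.
destruct (is_poly_le_S_inv _ _ Hp) as [r [c [Hr Hc]]].
destruct (is_monic_poly_S _ _ HQ) as [s [Hs HQs]].
exists (fun z => r z - c * s z), c; split.
- apply is_poly_le_minus; auto; now apply is_poly_le_scal.
- intros z; rewrite Hc, HQs; ring.
Qed.

Lemma OPUC_ortho_low (ell : R) (Phi : nat -> C -> C) (d m : nat) (p : C -> C) :
  is_monic_OPUC (nu_exp ell) Phi -> is_poly_le d p -> (d < m)%nat ->
  moment ell (fun z => Phi m z * Cconj (p z)) = 0.
Proof.
intros HPhi; revert p; induction d; intros p Hp Hd.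
- destruct (is_poly_le_0_inv _ Hp) as [c Hc].
  transitivity (moment ell (fun z => Cconj c * (Phi m z * Cconj (Phi 0%nat z)))).
  + apply moment_ext; intros z _ _; rewrite Hc, (is_monic_poly_0 _ (proj1 HPhi 0%nat)).
    rewrite Cconj_RtoC; ring.
  + assert (C0 := circ_cont_poly _ (OPUC_is_poly _ _ 0 HPhi)).
    assert (Cm := circ_cont_poly _ (OPUC_is_poly _ _ m HPhi)).
    rewrite moment_scal, OPUC_ortho by (auto; try lia; circ_cont_tac); ring.
- destruct (poly_split_monic _ _ _ Hp (proj1 HPhi (S d))) as [r [c [Hr Hc]]].
  assert (C0 := circ_cont_poly _ (OPUC_is_poly _ _ (S d) HPhi)).
  assert (Cm := circ_cont_poly _ (OPUC_is_poly _ _ m HPhi)).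
  transitivity (moment ell (fun z => Phi m z * Cconj (r z) +
     Cconj c * (Phi m z * Cconj (Phi (S d) z)))).
  + apply moment_ext; intros z _ _; rewrite Hc, Cplus_conj, Cmult_conj; ring.
  + rewrite moment_plus, moment_scal, IHd, OPUC_ortho by (auto; try lia; circ_cont_tac); ring.
Qed.

(** Orthogonality without conjugates, since conj(z^m) = z^(-m) on the circle; later arguments use it
    in this form. *)
Lemma OPUC_ortho_pow (ell : R) (Phi : nat -> C -> C) (n m : nat) :
  is_monic_OPUC (nu_exp ell) Phi -> (m < n)%nat ->
  moment ell (fun z => Phi n z / z ^ m) = 0.
Proof.
intros HPhi Hm.
rewrite <- (OPUC_ortho_low ell Phi m n (fun z => z ^ m) HPhi); auto.
2: now apply is_poly_le_pow.
apply moment_ext; intros z Hz Hc; rewrite Cpow_conj, Hc, Cpow_inv; auto.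
Qed.

Lemma moment_zero_conj (ell : R) (d : nat) (p r : C -> C) :
  is_poly p -> is_poly_le d r ->
  (forall m, (m <= d)%nat -> moment ell (fun z => p z / z ^ m) = 0) ->
  moment ell (fun z => p z * Cconj (r z)) = 0.
Proof.
intros Hp; assert (Cp := circ_cont_poly _ Hp); revert r; induction d; intros r Hr H.
- destruct (is_poly_le_0_inv _ Hr) as [c Hc].
  transitivity (moment ell (fun z => Cconj c * (p z / z ^ 0))).
  + apply moment_ext; intros z _ _; rewrite Hc; simpl; field.
  + rewrite moment_scal, H by (auto; circ_cont_tac); ring.
- destruct (is_poly_le_S_inv _ _ Hr) as [s [c [Hs Hc]]].
  transitivity (moment ell (fun z => p z * Cconj (s z) + Cconj c * (p z / z ^ S d))).
  + apply moment_ext; intros z Hz Hzc.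
    rewrite Hc, Cplus_conj, Cmult_conj, Cpow_conj, Hzc, Cpow_inv by auto.
    unfold Cdiv; ring.
  + rewrite moment_plus, moment_scal, IHd, H by (auto; circ_cont_tac); ring.
Qed.

(** Pairing p with Phi_d isolates its leading coefficient in the basis Phi_0, ..., Phi_d, because
    the squared norm of Phi_d is nonzero; descend on d. *)
Lemma OPUC_complete (ell : R) (Phi : nat -> C -> C) (d : nat) (p : C -> C) :
  is_monic_OPUC (nu_exp ell) Phi -> is_poly_le d p ->
  (forall m, (m <= d)%nat -> moment ell (fun z => p z / z ^ m) = 0) ->
  forall z, p z = 0.
Proof.
intros HPhi Hp H.
assert (H' : forall k, (k <= d)%nat -> moment ell (fun z => p z * Cconj (Phi k z)) = 0).
{ intros k Hk; apply moment_zero_conj with (d := k); eauto using is_poly_of_le.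
  - eapply OPUC_is_poly_le, HPhi.
  - intros; apply H; lia. }
clear H; revert p Hp H'; induction d; intros p Hp H.
- destruct (is_poly_le_0_inv _ Hp) as [c Hc]; intros z; rewrite Hc.
  specialize (H 0%nat (le_n 0)).
  assert (C0 := circ_cont_poly _ (OPUC_is_poly _ _ 0 HPhi)).
  apply (Cmult_cancel_r (moment ell (fun z => Phi 0%nat z * Cconj (Phi 0%nat z))));
    [ | now apply OPUC_norm].
  rewrite <- moment_scal, Cmult_0_l, <- H by circ_cont_tac.
  apply moment_ext; intros w _ _; rewrite Hc, (is_monic_poly_0 _ (proj1 HPhi 0%nat)); ring.
- destruct (poly_split_monic _ _ _ Hp (proj1 HPhi (S d))) as [r [c [Hr Hc]]].
  assert (C0 := circ_cont_poly _ (OPUC_is_poly _ _ (S d) HPhi)).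
  assert (Cr := circ_cont_poly _ (is_poly_of_le _ _ Hr)).
  assert (c0 : c = 0).
  { apply (Cmult_cancel_r (moment ell (fun z => Phi (S d) z * Cconj (Phi (S d) z))));
      [ | now apply OPUC_norm].
    rewrite Cmult_0_l, <- (H (S d) (le_n _)).
    transitivity (moment ell (fun z => r z * Cconj (Phi (S d) z) +
       c * (Phi (S d) z * Cconj (Phi (S d) z)))).
    - rewrite moment_plus, moment_scal by circ_cont_tac.
      replace (moment ell (fun z => r z * Cconj (Phi (S d) z))) with (RtoC 0); [ring | ].
      transitivity (moment ell (fun z => Cconj (Phi (S d) z * Cconj (r z)))).
      + rewrite moment_conj, (OPUC_ortho_low ell Phi d) by (auto; circ_cont_tac).
        symmetry; apply Cconj_RtoC.
      + apply moment_ext; intros z _ _; rewrite Cmult_conj, Cconj_conj; ring.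
    - apply moment_ext; intros z _ _; rewrite Hc; ring. }
  assert (Hpr : forall z, p z = r z) by (intros z; rewrite Hc, c0; ring).
  intros z; apply (IHd p); [ | intros; apply H; lia].
  revert Hr; apply is_poly_le_ext; auto.
Qed.

(** The circle avoids 0, so a polynomial vanishing off 0 has only zero moments, and [OPUC_complete]
    makes it zero everywhere. *)
Lemma OPUC_poly_ext (ell : R) (Phi : nat -> C -> C) (p q : C -> C) :
  is_monic_OPUC (nu_exp ell) Phi -> is_poly p -> is_poly q ->
  (forall z : C, z <> 0 -> p z = q z) -> forall z, p z = q z.
Proof.
intros HPhi Hp Hq H z.
destruct (is_poly_minus _ _ Hp Hq) as [d Hd].
assert (Hz : p z - q z = 0).
{ apply (OPUC_complete ell Phi d (fun z => p z - q z) HPhi Hd).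
  intros m _; transitivity (moment ell (fun z => 0 * (p z / z ^ m))).
  - apply moment_ext; intros w Hw _; rewrite H by auto.
    field; now apply Cpow_nz.
  - assert (Cp := circ_cont_poly _ Hp); rewrite moment_scal by circ_cont_tac; ring. }
replace (p z) with (p z - q z + q z) by ring; rewrite Hz; ring.
Qed.

(** The weight is even in the angle, so conj(Phi_n(conj z)) is again monic and orthogonal to lower
    powers. Its difference with Phi_n has degree below n and no nonzero moment. *)
Lemma OPUC_real (ell : R) (Phi : nat -> C -> C) (n : nat) (z : C) :
  is_monic_OPUC (nu_exp ell) Phi -> Cconj (Phi n (Cconj z)) = Phi n z.
Proof.
intros HPhi; destruct n.
{ rewrite !(is_monic_poly_0 _ (proj1 HPhi 0%nat)); apply Cconj_RtoC. }
destruct (is_monic_poly_S _ _ (proj1 HPhi (S n))) as [r [Hr Hc]].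
assert (C0 := circ_cont_poly _ (OPUC_is_poly _ _ (S n) HPhi)).
set (p := fun z => Cconj (Phi (S n) (Cconj z)) - Phi (S n) z).
assert (Cc : circ_cont (fun z => Cconj (Phi (S n) (Cconj z)))).
{ destruct (is_poly_le_conj _ _ (OPUC_is_poly_le _ _ (S n) HPhi)) as [c Hcc].
  apply circ_cont_poly; exists (S n), c; exact Hcc. }
assert (Hp : is_poly_le n p).
{ apply (is_poly_le_ext _ (fun z => Cconj (r (Cconj z)) - r z)).
  - intros w; unfold p; rewrite !Hc, Cplus_conj, Cpow_conj, Cconj_conj; ring.
  - apply is_poly_le_minus; auto; now apply is_poly_le_conj. }
assert (H0 : p z = 0).
{ apply (OPUC_complete ell Phi n); auto; intros m Hm.
  transitivity (moment ell (fun z => Cconj (Phi (S n) (Cconj z)) / z ^ m - Phi (S n) z / z ^ m)).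
  { apply moment_ext; intros w Hw _; unfold p; field; now apply Cpow_nz. }
  rewrite moment_minus, (OPUC_ortho_pow ell Phi (S n) m HPhi) by (try lia; circ_cont_tac).
  replace (moment ell (fun z => Cconj (Phi (S n) (Cconj z)) / z ^ m)) with (RtoC 0); [ring | ].
  assert (Cm : circ_cont (fun z => Phi (S n) z / z ^ m)) by circ_cont_tac.
  (* On the circle conj z = 1/z, so the moment is the conjugate of a reflected moment of Phi_{n+1} /
     z^m, which is zero. *)
  transitivity (moment ell (fun z => Cconj (Phi (S n) (/ z) / (/ z) ^ m))).
  - rewrite (moment_conj ell (fun z => Phi (S n) (/ z) / (/ z) ^ m)),
      (moment_reflect ell (fun z => Phi (S n) z / z ^ m)), (OPUC_ortho_pow ell Phi (S n) m HPhi)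
      by (try lia; auto; apply (circ_cont_reflect _ Cm)).
    symmetry; apply Cconj_RtoC.
  - apply moment_ext; intros w Hw Hwc.
    assert (Hiw := Cinv_nz w Hw).
    unfold Cdiv; rewrite Cmult_conj, Cinv_conj, Cpow_conj, Cinv_conj, Hwc by auto using Cpow_nz.
    now rewrite Cinv_invol. }
replace (Cconj _) with (p z + Phi (S n) z) by (unfold p; ring).
rewrite H0; ring.
Qed.

(** * Recurrences *)

(** This is the squared norm of Phi_n: z^n differs from Phi_n by a polynomial of lower degree,
    orthogonal to Phi_n. *)
Definition OPUC_sqnorm (ell : R) (Phi : nat -> C -> C) (n : nat) : C :=
  moment ell (fun z => Phi n z / z ^ n).

Lemma OPUC_sqnorm_nz (ell : R) (Phi : nat -> C -> C) (n : nat) :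
  is_monic_OPUC (nu_exp ell) Phi -> OPUC_sqnorm ell Phi n <> 0.
Proof.
intros HPhi; assert (H := OPUC_norm ell Phi n HPhi).
assert (C0 := circ_cont_poly _ (OPUC_is_poly _ _ n HPhi)).
intros H0; apply H; clear H; rewrite <- H0; unfold OPUC_sqnorm.
destruct n.
- apply moment_ext; intros z _ _; rewrite (is_monic_poly_0 _ (proj1 HPhi 0%nat)), Cconj_RtoC.
  simpl; field.
- destruct (is_monic_poly_S _ _ (proj1 HPhi (S n))) as [r [Hr Hc]].
  assert (Cr := circ_cont_poly _ (is_poly_of_le _ _ Hr)).
  transitivity (moment ell (fun z => Phi (S n) z * Cconj (r z) + Phi (S n) z / z ^ S n)).
  + apply moment_ext; intros z Hz Hzc.
    rewrite (Hc z) at 2; rewrite Cplus_conj, Cpow_conj, Hzc, Cpow_inv by auto.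
    unfold Cdiv; ring.
  + rewrite moment_plus, (OPUC_ortho_low ell Phi n) by (auto; circ_cont_tac); ring.
Qed.

(** * Reversed polynomials and the Szego recurrence *)

Lemma is_poly_le_reverse (n : nat) (p : C -> C) : is_poly_le n p ->
  exists q, is_poly_le n q /\ forall z : C, z <> 0 -> q z = z ^ n * p (/ z).
Proof.
revert p; induction n; intros p Hp.
- exists p; split; auto; intros z _.
  destruct (is_poly_le_0_inv _ Hp) as [c Hc]; rewrite !Hc; simpl; ring.
- destruct (is_poly_le_S_inv _ _ Hp) as [r [c [Hr Hc]]].
  destruct (IHn _ Hr) as [q [Hq Hqr]].
  exists (fun z => z * q z + c); split.
  + apply is_poly_le_plus; [now apply is_poly_le_mulX | ].
    apply (is_poly_le_le 0); [lia | apply is_poly_le_const].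
  + intros z Hz; rewrite Hqr, Hc, Cpow_inv by auto.
    assert (Hw := Cpow_nz z n Hz); simpl (z ^ S n).
    set (w := z ^ n) in *; field; auto.
Qed.

(** Reversal moves the leading coefficient 1 to the constant term; this fixes the value of [Phis n]
    at 0, where the defining formula says nothing. *)
Lemma is_monic_poly_reverse (n : nat) (p : C -> C) : is_monic_poly n p ->
  exists q, is_poly_le n q /\ q 0 = 1 /\ forall z : C, z <> 0 -> q z = z ^ n * p (/ z).
Proof.
intros Hp; destruct n.
- exists (fun _ => 1); split; [apply is_poly_le_const | split; auto].
  intros z _; rewrite (is_monic_poly_0 _ Hp); simpl; ring.
- destruct (is_monic_poly_S _ _ Hp) as [r [Hr Hc]].
  destruct (is_poly_le_reverse _ _ Hr) as [q [Hq Hqr]].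
  exists (fun z => z * q z + 1); split; [ | split].
  + apply is_poly_le_plus; [now apply is_poly_le_mulX | ].
    apply (is_poly_le_le 0); [lia | apply is_poly_le_const].
  + ring.
  + intros z Hz; rewrite Hqr, Hc, Cpow_inv by auto.
    assert (Hw := Cpow_nz z n Hz); simpl (z ^ S n).
    set (w := z ^ n) in *; field; auto.
Qed.

Lemma reversed_off_0 (ell : R) (Phi Phis : nat -> C -> C) (n : nat) (z : C) :
  is_monic_OPUC (nu_exp ell) Phi -> is_reversed Phi Phis -> z <> 0 ->
  Phis n z = z ^ n * Phi n (/ z).
Proof.
intros HPhi HPhis Hz; rewrite (proj2 (HPhis n) z Hz).
rewrite <- (OPUC_real ell Phi n (/ z) HPhi), Cinv_conj by auto; reflexivity.
Qed.

Lemma reversed_at_0 (ell : R) (Phi Phis : nat -> C -> C) (n : nat) :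
  is_monic_OPUC (nu_exp ell) Phi -> is_reversed Phi Phis -> Phis n 0 = 1.
Proof.
intros HPhi HPhis.
destruct (is_monic_poly_reverse _ _ (proj1 HPhi n)) as [q [Hq [Hq0 Hqr]]].
rewrite <- Hq0; apply (OPUC_poly_ext ell Phi (Phis n) q HPhi).
- eapply is_poly_of_le, HPhis.
- eapply is_poly_of_le, Hq.
- intros z Hz; now rewrite (reversed_off_0 ell Phi Phis), Hqr.
Qed.

Lemma reversed_0 (ell : R) (Phi Phis : nat -> C -> C) (z : C) :
  is_monic_OPUC (nu_exp ell) Phi -> is_reversed Phi Phis -> Phis 0%nat z = 1.
Proof.
intros HPhi HPhis; destruct (is_poly_le_0_inv _ (proj1 (HPhis 0%nat))) as [c Hc].
now rewrite <- (reversed_at_0 ell Phi Phis 0 HPhi HPhis), !Hc.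
Qed.

Lemma Cpow_sub (z : C) (n m : nat) : z <> 0 -> (m <= n)%nat -> z ^ (n - m) = z ^ n / z ^ m.
Proof.
intros Hz Hm; replace n with ((n - m) + m)%nat at 2 by lia.
rewrite Cpow_add_r; field; now apply Cpow_nz.
Qed.

Lemma reversed_moment (ell : R) (Phi Phis : nat -> C -> C) (n m : nat) :
  is_monic_OPUC (nu_exp ell) Phi -> is_reversed Phi Phis -> (m <= n)%nat ->
  moment ell (fun z => Phis n z / z ^ m) = moment ell (fun z => Phi n z / z ^ (n - m)).
Proof.
intros HPhi HPhis Hm.
assert (C0 := circ_cont_poly _ (OPUC_is_poly _ _ n HPhi)).
rewrite <- (moment_reflect ell (fun z => Phi n z / z ^ (n - m))) by circ_cont_tac.
apply moment_ext; intros z Hz _.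
rewrite (reversed_off_0 ell Phi Phis), Cpow_inv, Cpow_sub by auto.
field; auto using Cpow_nz.
Qed.

(** The reflection of [reversed_moment] at m = n + 1, where the exponent n - m is -1 and truncated
    subtraction would give 0. The trivial [z ^ 0] keeps the shape of the terms in [moment_parts]. *)
Lemma reversed_moment_S (ell : R) (Phi Phis : nat -> C -> C) (n : nat) :
  is_monic_OPUC (nu_exp ell) Phi -> is_reversed Phi Phis ->
  moment ell (fun z => Phis n z / z ^ S n) = moment ell (fun z => z * Phi n z / z ^ 0).
Proof.
intros HPhi HPhis.
assert (C0 := circ_cont_poly _ (OPUC_is_poly _ _ n HPhi)).
rewrite <- (moment_reflect ell (fun z => z * Phi n z / z ^ 0)) by circ_cont_tac.
apply moment_ext; intros z Hz _.
rewrite (reversed_off_0 ell Phi Phis) by auto; simpl.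
field; auto using Cpow_nz.
Qed.

Lemma reversed_ortho (ell : R) (Phi Phis : nat -> C -> C) (n m : nat) :
  is_monic_OPUC (nu_exp ell) Phi -> is_reversed Phi Phis -> (1 <= m <= n)%nat ->
  moment ell (fun z => Phis n z / z ^ m) = 0.
Proof.
intros HPhi HPhis Hm; rewrite (reversed_moment ell Phi Phis) by (auto; lia).
apply OPUC_ortho_pow; auto; lia.
Qed.

Lemma reversed_moment_0 (ell : R) (Phi Phis : nat -> C -> C) (n : nat) :
  is_monic_OPUC (nu_exp ell) Phi -> is_reversed Phi Phis ->
  moment ell (fun z => Phis n z / z ^ 0) = OPUC_sqnorm ell Phi n.
Proof.
intros HPhi HPhis; rewrite (reversed_moment ell Phi Phis) by (auto; lia).
now rewrite Nat.sub_0_r.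
Qed.

Lemma moment_mulX (ell : R) (p : C -> C) (m : nat) :
  moment ell (fun z => z * p z / z ^ S m) = moment ell (fun z => p z / z ^ m).
Proof.
apply moment_ext; intros z Hz _; simpl; field; auto using Cpow_nz.
Qed.

Lemma OPUC_sub_mulX_poly (nu : C -> C) (Phi : nat -> C -> C) (n : nat) :
  is_monic_OPUC nu Phi -> is_poly_le n (fun z => Phi (S n) z - z * Phi n z).
Proof.
intros HPhi.
destruct (is_monic_poly_S _ _ (proj1 HPhi (S n))) as [r [Hr Hc]].
destruct n.
- apply (is_poly_le_ext _ r); auto; intros z.
  rewrite Hc, (is_monic_poly_0 _ (proj1 HPhi 0%nat)); simpl; ring.
- destruct (is_monic_poly_S _ _ (proj1 HPhi (S n))) as [s [Hs Hcs]].
  apply (is_poly_le_ext _ (fun z => r z - z * s z)).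
  + intros z; rewrite Hc, Hcs; simpl; ring.
  + apply is_poly_le_minus; auto; now apply is_poly_le_mulX.
Qed.

(** Phi_{n+1} - z Phi_n has degree at most n and its moments for 1 <= m <= n vanish, as do those of
    Phi*_n; only m = 0 remains to be matched. The value of that moment is kept as a second
    conclusion because the norm ratio and the formula for z Phi_n' need it. *)
Lemma Szego_with_moment (ell : R) (Phi Phis : nat -> C -> C) (n : nat) :
  is_monic_OPUC (nu_exp ell) Phi -> is_reversed Phi Phis ->
  (forall z, Phi (S n) z = z * Phi n z + Phi (S n) 0 * Phis n z) /\
  moment ell (fun z => z * Phi n z / z ^ 0) = - Phi (S n) 0 * OPUC_sqnorm ell Phi n.
Proof.
intros HPhi HPhis.
assert (C0 := circ_cont_poly _ (OPUC_is_poly _ _ n HPhi)).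
assert (C1 := circ_cont_poly _ (OPUC_is_poly _ _ (S n) HPhi)).
assert (CQ := circ_cont_poly _ (is_poly_of_le _ _ (proj1 (HPhis n)))).
assert (Hh := OPUC_sqnorm_nz ell Phi n HPhi).
(* Chosen to cancel the moment at m = 0; evaluation at 0, where [Phis n] is 1, then identifies it
   with [Phi (S n) 0]. *)
set (lam := - moment ell (fun z => z * Phi n z / z ^ 0) / OPUC_sqnorm ell Phi n).
set (D := fun z => Phi (S n) z - z * Phi n z - lam * Phis n z).
assert (HD : forall z, D z = 0).
{ apply (OPUC_complete ell Phi n D HPhi).
  - apply is_poly_le_minus; [apply (OPUC_sub_mulX_poly _ _ _ HPhi) | ].
    apply is_poly_le_scal, HPhis.
  - intros m Hm; transitivity (moment ell (fun z => Phi (S n) z / z ^ m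
      - z * Phi n z / z ^ m - lam * (Phis n z / z ^ m))).
    { apply moment_ext; intros z Hz _; unfold D; field; now apply Cpow_nz. }
    rewrite !moment_minus, moment_scal, (OPUC_ortho_pow ell Phi (S n)) by (auto; try lia; circ_cont_tac).
    destruct m as [ | m].
    + rewrite (reversed_moment_0 ell Phi Phis) by auto; unfold lam; field; auto.
    + rewrite moment_mulX, (OPUC_ortho_pow ell Phi), (reversed_ortho ell Phi Phis) by (auto; lia); ring. }
assert (Hlam : Phi (S n) 0 = lam).
{ specialize (HD 0); unfold D in HD; rewrite (reversed_at_0 ell Phi Phis) in HD by auto.
  replace lam with (Phi (S n) 0 - (Phi (S n) 0 - 0 * Phi n 0 - lam * 1)) by ring.
  rewrite HD; ring. }
rewrite Hlam; split.
- intros z; replace (Phi (S n) z) with (D z + (z * Phi n z + lam * Phis n z)) by (unfold D; ring).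
  rewrite HD; ring.
- unfold lam; field; auto.
Qed.

Lemma Szego (ell : R) (Phi Phis : nat -> C -> C) (n : nat) (z : C) :
  is_monic_OPUC (nu_exp ell) Phi -> is_reversed Phi Phis ->
  Phi (S n) z = z * Phi n z + Phi (S n) 0 * Phis n z.
Proof. intros HPhi HPhis; now apply (Szego_with_moment ell Phi Phis). Qed.

Lemma Szego_reversed (ell : R) (Phi Phis : nat -> C -> C) (n : nat) :
  is_monic_OPUC (nu_exp ell) Phi -> is_reversed Phi Phis ->
  forall z, Phis (S n) z = Phis n z + Phi (S n) 0 * (z * Phi n z).
Proof.
intros HPhi HPhis.
apply (OPUC_poly_ext ell Phi _ _ HPhi).
- eapply is_poly_of_le, HPhis.
- apply is_poly_plus; [eapply is_poly_of_le, HPhis | ].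
  apply is_poly_mult; [apply is_poly_const | apply is_poly_mult; [apply is_poly_id | ]].
  eapply OPUC_is_poly, HPhi.
- intros z Hz.
  assert (Hiz := Cinv_nz z Hz); assert (Hw := Cpow_nz z n Hz).
  rewrite !(reversed_off_0 ell Phi Phis _ z) by auto.
  rewrite (Szego ell Phi Phis n (/ z)), (reversed_off_0 ell Phi Phis n (/ z)) by auto.
  rewrite Cpow_inv, Cinv_invol by auto; simpl (z ^ S n).
  set (w := z ^ n) in *; field; auto.
Qed.

(** Inserting the Szego recurrence into Phi_{n+1} / z^(n+1), the first term gives the previous norm,
    and the second reflects to the moment of z Phi_n. *)
Lemma OPUC_sqnorm_S (ell : R) (Phi Phis : nat -> C -> C) (n : nat) :
  is_monic_OPUC (nu_exp ell) Phi -> is_reversed Phi Phis ->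
  OPUC_sqnorm ell Phi (S n) = OPUC_sqnorm ell Phi n * (1 - Phi (S n) 0 ^ 2).
Proof.
intros HPhi HPhis.
assert (C0 := circ_cont_poly _ (OPUC_is_poly _ _ n HPhi)).
assert (CQ := circ_cont_poly _ (is_poly_of_le _ _ (proj1 (HPhis n)))).
transitivity (moment ell (fun z => z * Phi n z / z ^ S n + Phi (S n) 0 * (Phis n z / z ^ S n))).
- apply moment_ext; intros z Hz _; rewrite (Szego ell Phi Phis n z) by auto.
  field; now apply Cpow_nz.
- rewrite moment_plus, moment_scal, moment_mulX, (reversed_moment_S ell Phi Phis),
    (proj2 (Szego_with_moment ell Phi Phis n HPhi HPhis)) by (auto; circ_cont_tac).
  unfold OPUC_sqnorm; ring.
Qed.

(** * Differentiation formula and first-order system *)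

Lemma OPUC_derive_poly (nu : C -> C) (Phi : nat -> C -> C) (n : nat) :
  is_monic_OPUC nu Phi ->
  is_poly_le n (fun z => z * C_derive (Phi (S n)) z - RtoC (INR (S n)) * Phi (S n) z).
Proof.
intros HPhi.
destruct (is_monic_poly_S _ _ (proj1 HPhi (S n))) as [r [Hr Hc]].
destruct (is_poly_le_derive _ _ Hr) as [H1 [_ [H3 _]]].
assert (HdPhi : forall z, C_derive (Phi (S n)) z = C_derive r z + RtoC (INR (S n)) * z ^ n).
{ intros z; apply is_C_derive_unique.
  apply (is_derive_ext (V := C_NormedModule) (fun z => r z + z ^ S n)); [intros; symmetry; apply Hc | ].
  apply is_C_derive_plus; [apply H3 | apply is_C_derive_pow]. }
apply (is_poly_le_ext _ (fun z => z * C_derive r z - RtoC (INR (S n)) * r z)).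
- intros z; rewrite HdPhi, Hc; simpl (z ^ S n); generalize (z ^ n) (RtoC (INR (S n))); intros; ring.
- apply is_poly_le_minus; auto; now apply is_poly_le_scal.
Qed.

(** After [moment_parts] only two kinds of moments of Phi_{n+1} survive: with exponent m + 1,
    nonzero only for m = n, and with exponent m - 1, nonzero only for m = 0. Among 0 <= m <= n,
    Phi_n has a nonzero moment only at m = n and Phi*_n only at m = 0, so these two polynomials
    absorb them; 1 - Phi_{n+1}(0)^2 is the ratio of squared norms. *)
Lemma OPUC_derive (ell : R) (Phi Phis : nat -> C -> C) (n : nat) :
  is_monic_OPUC (nu_exp ell) Phi -> is_reversed Phi Phis ->
  forall z, z * C_derive (Phi (S n)) z =
    RtoC (INR (S n)) * Phi (S n) z +
    RtoC ell / 2 * (1 - Phi (S n) 0 ^ 2) * (Phi n z + Phi (S (S n)) 0 * Phis n z).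
Proof.
intros HPhi HPhis.
assert (C0 := circ_cont_poly _ (OPUC_is_poly _ _ n HPhi)).
assert (C1 := circ_cont_poly _ (OPUC_is_poly _ _ (S n) HPhi)).
assert (CQ := circ_cont_poly _ (is_poly_of_le _ _ (proj1 (HPhis n)))).
assert (CD : circ_cont (C_derive (Phi (S n)))).
{ apply circ_cont_poly; exists (S n); apply is_poly_le_derive; eapply OPUC_is_poly_le, HPhi. }
set (N := RtoC (INR (S n))); set (p := RtoC ell / 2 * (1 - Phi (S n) 0 ^ 2)).
set (q := p * Phi (S (S n)) 0).
set (D := fun z => z * C_derive (Phi (S n)) z - N * Phi (S n) z - p * Phi n z - q * Phis n z).
assert (HD : forall z, D z = 0).
{ apply (OPUC_complete ell Phi n D HPhi).
  - apply is_poly_le_minus; [apply is_poly_le_minus | ].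
    + apply (OPUC_derive_poly _ _ n HPhi).
    + apply is_poly_le_scal; eapply OPUC_is_poly_le, HPhi.
    + apply is_poly_le_scal, HPhis.
  - intros m Hm; transitivity (moment ell (fun z => z * C_derive (Phi (S n)) z / z ^ m
      - N * (Phi (S n) z / z ^ m) - p * (Phi n z / z ^ m) - q * (Phis n z / z ^ m))).
    { apply moment_ext; intros z Hz _; unfold D; field; now apply Cpow_nz. }
    rewrite !moment_minus, !moment_scal by circ_cont_tac.
    rewrite moment_parts by (eapply OPUC_is_poly, HPhi).
    rewrite (OPUC_ortho_pow ell Phi (S n) m) by (auto; lia).
    assert (E1 : moment ell (fun z => Phi (S n) z / z ^ S m) =
      (1 - Phi (S n) 0 ^ 2) * moment ell (fun z => Phi n z / z ^ m)).
    { destruct (Nat.eq_dec m n) as [-> | Hmn].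
      - change (OPUC_sqnorm ell Phi (S n) = (1 - Phi (S n) 0 ^ 2) * OPUC_sqnorm ell Phi n).
        rewrite (OPUC_sqnorm_S ell Phi Phis) by auto; ring.
      - rewrite !(OPUC_ortho_pow ell Phi) by (auto; lia); ring. }
    assert (E2 : moment ell (fun z => z * Phi (S n) z / z ^ m) =
      - (1 - Phi (S n) 0 ^ 2) * Phi (S (S n)) 0 * moment ell (fun z => Phis n z / z ^ m)).
    { destruct m as [ | m].
      - rewrite (proj2 (Szego_with_moment ell Phi Phis (S n) HPhi HPhis)), (reversed_moment_0 ell Phi Phis),
          (OPUC_sqnorm_S ell Phi Phis) by auto; ring.
      - rewrite moment_mulX, (OPUC_ortho_pow ell Phi), (reversed_ortho ell Phi Phis) by (auto; lia); ring. }
    rewrite E1, E2; unfold q, p; ring. }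
intros z; transitivity (D z + (N * Phi (S n) z + p * Phi n z + q * Phis n z)).
- unfold D; ring.
- rewrite HD; unfold q; ring.
Qed.

Lemma discrete_Painleve (ell : R) (Phi : nat -> C -> C) (Phis : nat -> C -> C) (n : nat) :
  is_monic_OPUC (nu_exp ell) Phi -> is_reversed Phi Phis ->
  RtoC (INR (S n)) * Phi (S n) 0 =
    - (RtoC ell / 2 * (1 - Phi (S n) 0 ^ 2) * (Phi n 0 + Phi (S (S n)) 0)).
Proof.
intros HPhi HPhis; assert (H := OPUC_derive ell Phi Phis n HPhi HPhis 0).
rewrite (reversed_at_0 ell Phi Phis) in H by auto.
rewrite Cmult_0_l in H; symmetry in H.
set (X := RtoC ell / 2 * (1 - Phi (S n) 0 ^ 2) * (Phi n 0 + Phi (S (S n)) 0)).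
transitivity (RtoC (INR (S n)) * Phi (S n) 0 + RtoC ell / 2 * (1 - Phi (S n) 0 ^ 2) *
   (Phi n 0 + Phi (S (S n)) 0 * 1) - X); [unfold X | rewrite H]; ring.
Qed.

Lemma OPUC_system_Phi (ell : R) (Phi Phis : nat -> C -> C) (n : nat) :
  is_monic_OPUC (nu_exp ell) Phi -> is_reversed Phi Phis ->
  forall z, z ^ 2 * C_derive (Phi (S n)) z =
    (RtoC (INR (S n)) * z + RtoC ell / 2 * (1 - Phi (S n) 0 ^ 2)) * Phi (S n) z +
    RtoC ell / 2 * (1 - Phi (S n) 0 ^ 2) * (Phi (S (S n)) 0 * z - Phi (S n) 0) * Phis n z.
Proof.
intros HPhi HPhis z.
replace (z ^ 2 * C_derive (Phi (S n)) z) with (z * (z * C_derive (Phi (S n)) z)) by ring.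
rewrite (OPUC_derive ell Phi Phis n HPhi HPhis z).
assert (H : z * Phi n z = Phi (S n) z - Phi (S n) 0 * Phis n z).
{ rewrite (Szego ell Phi Phis n z HPhi HPhis) at 1; ring. }
transitivity (RtoC (INR (S n)) * z * Phi (S n) z +
   RtoC ell / 2 * (1 - Phi (S n) 0 ^ 2) * (z * Phi n z + Phi (S (S n)) 0 * z * Phis n z)); [ring | ].
rewrite H; ring.
Qed.

(** The pair (Phi_n, Phi*_n) is the one exchanged by z -> 1/z, so the derivative of Phi*_n has to be
    read off from a system at equal indices. The two Szego recurrences combine to (1 - b^2) Phi*_n =
    Phi*_{n+1} - b Phi_{n+1}, with b = Phi_{n+1}(0), which performs the shift. *)
Lemma OPUC_system_same_index (ell : R) (Phi Phis : nat -> C -> C) (n : nat) :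
  is_monic_OPUC (nu_exp ell) Phi -> is_reversed Phi Phis ->
  forall z, z ^ 2 * C_derive (Phi n) z =
    (RtoC (INR n) * z + RtoC ell / 2 * (1 - Phi (S n) 0 * Phi n 0 * z)) * Phi n z +
    RtoC ell / 2 * (Phi (S n) 0 * z - Phi n 0) * Phis n z.
Proof.
intros HPhi HPhis z; destruct n as [ | n].
- rewrite (reversed_0 ell Phi Phis) by auto.
  rewrite !(is_monic_poly_0 _ (proj1 HPhi 0%nat)).
  replace (Phi 0%nat) with (fun _ : C => RtoC 1).
  2:{ apply functional_extensionality; intros w; symmetry; apply (is_monic_poly_0 _ (proj1 HPhi 0%nat)). }
  assert (H : C_derive (fun _ : C => RtoC 1) z = 0).
  { apply is_C_derive_unique, is_C_derive_const. }
  rewrite H; simpl; ring.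
- rewrite (OPUC_system_Phi ell Phi Phis n HPhi HPhis z).
  assert (H : (1 - Phi (S n) 0 ^ 2) * Phis n z = Phis (S n) z - Phi (S n) 0 * Phi (S n) z).
  { rewrite (Szego_reversed ell Phi Phis n), (Szego ell Phi Phis n z) by auto; ring. }
  transitivity ((RtoC (INR (S n)) * z + RtoC ell / 2 * (1 - Phi (S n) 0 ^ 2)) * Phi (S n) z +
    RtoC ell / 2 * (Phi (S (S n)) 0 * z - Phi (S n) 0) * ((1 - Phi (S n) 0 ^ 2) * Phis n z)); [ring | ].
  rewrite H; ring.
Qed.

Lemma is_C_derive_reverse (p : C -> C) (n : nat) (z dp : C) : z <> 0 ->
  is_derive (K := C_AbsRing) (V := C_NormedModule) p (/ z) dp ->
  is_derive (K := C_AbsRing) (V := C_NormedModule) (fun w => w ^ n * p (/ w)) z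
    (RtoC (INR n) * z ^ n / z * p (/ z) - z ^ n / z ^ 2 * dp).
Proof.
intros Hz Hp; eapply is_C_derive_eq.
- apply is_C_derive_mult; [ | apply (is_C_derive_comp p (fun w => / w)); [exact Hp | now apply is_C_derive_inv]].
  instantiate (1 := RtoC (INR n) * z ^ n / z).
  destruct n.
  + eapply is_C_derive_eq; [apply (is_C_derive_const 1) | simpl; field; auto].
  + eapply is_C_derive_eq; [apply is_C_derive_pow | simpl (z ^ S n)].
    generalize (z ^ n) (RtoC (INR (S n))); intros; field; auto.
- cbv beta; generalize (z ^ n) (RtoC (INR n)); intros; field; auto.
Qed.

Lemma locally_nz (z : C) : z <> 0 -> locally (T := AbsRing_UniformSpace C_AbsRing) z (fun w => w <> RtoC 0).
Proof.
intros Hz; exists (mkposreal _ (proj1 (Cmod_gt_0 z) Hz)); intros w Hw; change C in w.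
change (Cmod (w - z)%C < Cmod z)%R in Hw; intros ->.
replace (0 - z) with (- z) in Hw by ring; rewrite Cmod_opp in Hw; lra.
Qed.

Lemma OPUC_system_Phis (ell : R) (Phi Phis : nat -> C -> C) (n : nat) :
  is_monic_OPUC (nu_exp ell) Phi -> is_reversed Phi Phis ->
  forall z, z ^ 2 * C_derive (Phis n) z =
    RtoC ell / 2 * (Phi n 0 * z - Phi (S n) 0) * Phi (S n) z +
    RtoC ell / 2 * (Phi (S n) 0 ^ 2 - z ^ 2) * Phis n z.
Proof.
intros HPhi HPhis.
assert (P1 := OPUC_is_poly _ _ (S n) HPhi).
assert (P2 := is_poly_of_le _ _ (proj1 (HPhis n))).
assert (P3 : is_poly (C_derive (Phis n))).
{ exists n; apply is_poly_le_derive, HPhis. }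
apply (OPUC_poly_ext ell Phi _ _ HPhi).
{ apply is_poly_mult; auto; apply is_poly_pow, is_poly_id. }
{ unfold Cminus; auto 10 using is_poly_mult, is_poly_plus, is_poly_opp, is_poly_const, is_poly_id, is_poly_pow. }
intros z Hz.
assert (HdP := proj1 (proj2 (proj2 (is_poly_le_derive _ _ (OPUC_is_poly_le _ _ n HPhi))))).
assert (HQ : C_derive (Phis n) z =
  RtoC (INR n) * z ^ n / z * Phi n (/ z) - z ^ n / z ^ 2 * C_derive (Phi n) (/ z)).
{ apply is_C_derive_unique.
  apply (is_derive_ext_loc (V := C_NormedModule) (fun w => w ^ n * Phi n (/ w))).
  - generalize (locally_nz z Hz); apply filter_imp; intros w Hw.
    symmetry; now apply (reversed_off_0 ell Phi Phis n w).
  - apply is_C_derive_reverse; auto. }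
assert (Hsys := OPUC_system_same_index ell Phi Phis n HPhi HPhis (/ z)).
assert (Hw := Cpow_nz z n Hz).
rewrite (reversed_off_0 ell Phi Phis n (/ z)), (Cpow_inv z n), Cinv_invol in Hsys by auto using Cinv_nz.
rewrite (Szego ell Phi Phis n z HPhi HPhis), HQ, (reversed_off_0 ell Phi Phis n z) by auto.
set (w := z ^ n) in *.
replace (C_derive (Phi n) (/ z)) with (z ^ 2 * ((/ z) ^ 2 * C_derive (Phi n) (/ z))) by (field; auto).
rewrite Hsys; field; auto.
Qed.

(** * Second-order equations *)

Lemma is_poly_derive (p : C -> C) : is_poly p -> is_poly (C_derive p).
Proof. intros [d Hp]; exists d; now apply is_poly_le_derive. Qed.

Lemma is_poly_C_derive (p : C -> C) (z : C) : is_poly p ->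
  is_derive (K := C_AbsRing) (V := C_NormedModule) p z (C_derive p z).
Proof. intros [d Hp]; now apply (is_poly_le_derive d). Qed.

Lemma is_poly_curve_derive (p : C -> C) (th : R) : is_poly p ->
  curve_derive (fun t => p (circ t)) th (Ci * circ th * C_derive p (circ th)).
Proof. intros [d Hp]; now apply (is_poly_le_derive d). Qed.

Lemma is_poly_twice (p : C -> C) (z : C) : is_poly p -> twice_C_derivable p z.
Proof.
intros Hp; split; eexists; apply is_poly_C_derive; auto using is_poly_derive.
Qed.

Lemma is_C_derive_quad (a b c z : C) :
  is_derive (K := C_AbsRing) (V := C_NormedModule) (fun w => a * w ^ 2 + b * w + c) z (2 * a * z + b).
Proof.
eapply is_C_derive_eq.
- apply is_C_derive_plus; [apply is_C_derive_plus | apply is_C_derive_const];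
    apply is_C_derive_scal; [apply (is_C_derive_pow 1) | apply is_C_derive_id].
- simpl; rewrite RtoC_plus; ring.
Qed.

(** General quadratic coefficients cover both rows of the first-order system, with [P] and [Q]
    exchanged. *)
Lemma poly_system_derive (P Q : C -> C) (a b c d e f : C) : is_poly P -> is_poly Q ->
  (forall z, z ^ 2 * C_derive P z =
     (a * z ^ 2 + b * z + c) * P z + (d * z ^ 2 + e * z + f) * Q z) ->
  forall z, 2 * z * C_derive P z + z ^ 2 * C_derive (C_derive P) z =
     (2 * a * z + b) * P z + (a * z ^ 2 + b * z + c) * C_derive P z +
     ((2 * d * z + e) * Q z + (d * z ^ 2 + e * z + f) * C_derive Q z).
Proof.
intros HP HQ H z.
assert (H1 : C_derive (fun z => z ^ 2 * C_derive P z) z =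
  2 * z * C_derive P z + z ^ 2 * C_derive (C_derive P) z).
{ apply is_C_derive_unique; eapply is_C_derive_eq.
  - apply is_C_derive_mult; [apply (is_C_derive_pow 1) | apply is_poly_C_derive; now apply is_poly_derive].
  - simpl; rewrite RtoC_plus; ring. }
rewrite <- H1; apply is_C_derive_unique.
apply (is_derive_ext (V := C_NormedModule) (fun z => (a * z ^ 2 + b * z + c) * P z + (d * z ^ 2 + e * z + f) * Q z)).
{ intros; symmetry; apply H. }
eapply is_C_derive_eq.
- apply is_C_derive_plus; (apply is_C_derive_mult; [apply is_C_derive_quad | now apply is_poly_C_derive]).
- cbv beta; ring.
Qed.

(** The zeroth-order coefficient is written as g * z + e so that [Cauchy_ode_of_poly] applies to
    these equations as they are. *)
Lemma OPUC_second_order (ell : R) (Phi Phis : nat -> C -> C) (n : nat) :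
  is_monic_OPUC (nu_exp ell) Phi -> is_reversed Phi Phis ->
  let l := RtoC ell in
  let N := RtoC (INR (S n)) in
  let b := Phi (S n) 0 in
  let s := (1 - b ^ 2) * Phi (S (S n)) 0 * Phi n 0 - b ^ 2 in
  (forall z,
    z ^ 2 * C_derive (C_derive (Phi (S n))) z
    + (l / 2 * z ^ 2 + (2 - N) * z - l / 2) * C_derive (Phi (S n)) z
    + (- (l * N / 2) * z + (- (l ^ 2 / 4) - N - l ^ 2 / 4 * s)) * Phi (S n) z
    = l / 2 * (1 - b ^ 2) * Phi (S (S n)) 0 * Phis n z) /\
  (forall z,
    z ^ 2 * C_derive (C_derive (Phis n)) z
    + (l / 2 * z ^ 2 + (2 - N) * z - l / 2) * C_derive (Phis n) z
    + (- (l * (N / 2 - 1)) * z + (- (l ^ 2 / 4) - l ^ 2 / 4 * s)) * Phis n z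
    = l / 2 * Phi n 0 * Phi (S n) z).
Proof.
intros HPhi HPhis l N b s.
assert (HP := OPUC_is_poly _ _ (S n) HPhi).
assert (HQ := is_poly_of_le _ _ (proj1 (HPhis n))).
assert (HP1 := is_poly_derive _ HP); assert (HP2 := is_poly_derive _ HP1).
assert (HQ1 := is_poly_derive _ HQ); assert (HQ2 := is_poly_derive _ HQ1).
assert (E := OPUC_system_Phi ell Phi Phis n HPhi HPhis).
assert (F := OPUC_system_Phis ell Phi Phis n HPhi HPhis).
assert (Hd := discrete_Painleve ell Phi Phis n HPhi HPhis).
unfold s; fold l N b in E, F, Hd; clear s.
set (bp := Phi (S (S n)) 0) in *; set (bm := Phi n 0) in *.
assert (DE := poly_system_derive (Phi (S n)) (Phis n) 0 N (l / 2 * (1 - b ^ 2))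
  0 (l / 2 * (1 - b ^ 2) * bp) (- (l / 2 * (1 - b ^ 2) * b)) HP HQ).
assert (DF := poly_system_derive (Phis n) (Phi (S n)) (- (l / 2)) 0 (l / 2 * b ^ 2)
  0 (l / 2 * bm) (- (l / 2 * b)) HQ HP).
lapply DE; [clear DE; intros DE | intros z; rewrite E; ring].
lapply DF; [clear DF; intros DF | intros z; rewrite F; ring].
split; apply (OPUC_poly_ext ell Phi _ _ HPhi);
  try (unfold Cminus; auto 20 using is_poly_mult, is_poly_plus, is_poly_opp, is_poly_const, is_poly_id, is_poly_pow).
- intros z Hz; specialize (E z); specialize (F z); specialize (DE z).
  set (P := Phi (S n) z) in *; set (P1 := C_derive (Phi (S n)) z) in *.
  set (P2 := C_derive (C_derive (Phi (S n))) z) in *.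
  set (Q := Phis n z) in *; set (Q1 := C_derive (Phis n) z) in *.
  apply (Cmult_cancel_r (z ^ 2)); [ | now apply Cpow_nz].
  replace (z ^ 2 * P2) with ((2 * z * P1 + z ^ 2 * P2) - 2 * z * P1) by ring.
  rewrite DE.
  (* After multiplication by z^2 the first derivatives occur only as z^2 P' and z^2 Q', which the
     first-order system replaces. *)
  transitivity ((N * z + l / 2 * (1 - b ^ 2) + (l / 2 * z ^ 2 - N * z - l / 2)) * (z ^ 2 * P1)
    + l / 2 * (1 - b ^ 2) * (bp * z - b) * (z ^ 2 * Q1)
    + z ^ 2 * (N * P + l / 2 * (1 - b ^ 2) * bp * Q
       + (- (l * N / 2) * z + (- (l ^ 2 / 4) - N - l ^ 2 / 4 * ((1 - b ^ 2) * bp * bm - b ^ 2))) * P)).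
  { ring. }
  rewrite E, F.
  (* Everything cancels except a multiple of N b + (l/2)(1 - b^2)(bm + bp), which is zero by
     discrete Painleve II. *)
  transitivity (l / 2 * (1 - b ^ 2) * bp * Q * z ^ 2
    - l / 2 * b * z * P * (N * b + l / 2 * (1 - b ^ 2) * (bm + bp))); [field | ].
  rewrite Hd; ring.
- intros z Hz; specialize (E z); specialize (F z); specialize (DF z).
  set (P := Phi (S n) z) in *; set (P1 := C_derive (Phi (S n)) z) in *.
  set (Q := Phis n z) in *; set (Q1 := C_derive (Phis n) z) in *.
  set (Q2 := C_derive (C_derive (Phis n)) z) in *.
  apply (Cmult_cancel_r (z ^ 2)); [ | now apply Cpow_nz].
  replace (z ^ 2 * Q2) with ((2 * z * Q1 + z ^ 2 * Q2) - 2 * z * Q1) by ring.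
  rewrite DF.
  transitivity ((l / 2 * b ^ 2 - N * z - l / 2) * (z ^ 2 * Q1)
    + l / 2 * (bm * z - b) * (z ^ 2 * P1)
    + z ^ 2 * (- l * z * Q + l / 2 * bm * P
       + (- (l * (N / 2 - 1)) * z + (- (l ^ 2 / 4) - l ^ 2 / 4 * ((1 - b ^ 2) * bp * bm - b ^ 2))) * Q)).
  { field. }
  rewrite E, F.
  transitivity (l / 2 * bm * P * z ^ 2
    - l / 2 * b * z * Q * (N * b + l / 2 * (1 - b ^ 2) * (bm + bp))); [field | ].
  rewrite Hd; ring.
Qed.

(* Multiplication by the weight [nu(t) / t^n] turns the differential equations of the polynomials into those of
   their Cauchy transforms. *)
Lemma Cauchy_ode_of_poly (ell : R) (P Q : C -> C) (k : nat) (g e q c : C) :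
  is_poly P -> is_poly Q ->
  let l := RtoC ell in
  let N := RtoC (INR (S k)) in
  (forall z : C,
    z ^ 2 * C_derive (C_derive P) z
    + (l / 2 * z ^ 2 + (2 - N) * z - l / 2) * C_derive P z + (g * z + e) * P z = q * Q z) ->
  (g - l / 2) * moment ell (fun z => P z / z ^ k) = 0 ->
  let G := fun z => c * circle_int (fun t => P t / (t - z) * (nu_exp ell t / t ^ S k)) in
  let H := fun z => c * circle_int (fun t => Q t / (t - z) * (nu_exp ell t / t ^ S k)) in
  forall z : C, Cmod z <> 1%R ->
    twice_C_derivable G z /\
    z ^ 2 * C_derive (C_derive G) z
    + (- (l / 2) * z ^ 2 + (N + 2) * z + l / 2) * C_derive G z
    + ((g - l) * z + (e + N)) * G z = q * H z.
Proof.
intros HP HQ l N Hode Hm G H z Hz.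
set (w := fun t => weight ell t * / circ t ^ S k).
(* [v] is the logarithmic derivative of nu(t) / t^(k+1) and [v1] its derivative, so [F1] and [F2]
   below are (P w)' and (P w)''. *)
set (v := fun t => l / 2 - l / 2 * / circ t ^ 2 - N * / circ t ^ 1).
set (v1 := fun t => l * / circ t ^ 3 + N * / circ t ^ 2).
assert (Hcc : curve_cont circ) by apply curve_cont_circ.
assert (Hci : forall m, curve_cont (fun t => / circ t ^ m)).
{ intros m; apply curve_cont_inv; [now apply curve_cont_pow | ].
  intros; apply Cpow_nz, circ_nz. }
assert (Hcw : curve_cont w) by (apply curve_cont_mult; auto; apply curve_cont_weight).
assert (Hcv : curve_cont v).
{ unfold v; auto 10 using curve_cont_minus, curve_cont_mult, curve_cont_const. }
assert (Hcv1 : curve_cont v1).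
{ unfold v1; auto 10 using curve_cont_plus, curve_cont_mult, curve_cont_const. }
assert (Hdw : forall t, curve_derive w t (Ci * circ t * (v t * w t))).
{ intros t; eapply curve_derive_eq.
  - apply curve_derive_mult; [apply curve_derive_weight | apply curve_derive_circ_inv_pow].
  - unfold v, w; fold l N; assert (Hc := circ_nz t); assert (Hk := Cpow_nz _ k Hc).
    cbn [Cpow]; set (u := circ t ^ k) in *; field; auto. }
assert (Hdv : forall t, curve_derive v t (Ci * circ t * v1 t)).
{ intros t; eapply curve_derive_eq.
  - apply curve_derive_minus; [apply curve_derive_minus | ]; [apply curve_derive_const | | ];
      (apply curve_derive_mult; [apply curve_derive_const | apply curve_derive_circ_inv_pow]).
  - unfold v1; assert (Hc := circ_nz t); simpl; rewrite !RtoC_plus; field; auto. }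
set (F := fun t => P (circ t) * w t).
set (F1 := fun t => (C_derive P (circ t) + v t * P (circ t)) * w t).
set (F2 := fun t => (C_derive (C_derive P) (circ t) + 2 * v t * C_derive P (circ t)
   + (v1 t + v t ^ 2) * P (circ t)) * w t).
assert (HP1 := is_poly_derive _ HP); assert (HP2 := is_poly_derive _ HP1).
assert (CP := circ_cont_poly _ HP); assert (CP1 := circ_cont_poly _ HP1).
assert (CP2 := circ_cont_poly _ HP2); assert (CQ := circ_cont_poly _ HQ).
unfold circ_cont in *.
assert (HdF : forall t, curve_derive F t (Ci * circ t * F1 t)).
{ intros t; eapply curve_derive_eq.
  - apply curve_derive_mult; [now apply is_poly_curve_derive | apply Hdw].
  - unfold F1; ring. }
assert (HdF1 : forall t, curve_derive F1 t (Ci * circ t * F2 t)).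
{ intros t; eapply curve_derive_eq.
  - apply curve_derive_mult; [apply curve_derive_plus | apply Hdw].
    + now apply is_poly_curve_derive.
    + apply curve_derive_mult; [apply Hdv | now apply is_poly_curve_derive].
  - unfold F2; ring. }
assert (Hw0 : w (2 * PI)%R = w 0%R).
{ unfold w, weight; now rewrite circ_2PI, cos_2PI, cos_0. }
assert (Hv0 : v (2 * PI)%R = v 0%R) by (unfold v; now rewrite circ_2PI).
assert (HG : forall (R : C -> C) u, c * circle_int (fun t => R t / (t - u) * (nu_exp ell t / t ^ S k)) =
   c * Cauchy_transf (fun t => R (circ t) * w t) u).
{ intros R u; f_equal; apply circ_RInt_ext; intros t; cbv beta.
  rewrite Cexp_circ, nu_exp_circ; unfold w, Cdiv; ring. }
unfold H; rewrite (HG Q z).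
apply (Cauchy_transf_ode F F1 F2 (fun t => Q (circ t) * w t)); auto.
- unfold F2; auto 10 using curve_cont_mult, curve_cont_plus, curve_cont_pow, curve_cont_const.
- now apply curve_cont_mult.
- unfold F; now rewrite Hw0, circ_2PI.
- unfold F1; now rewrite Hw0, Hv0, circ_2PI.
(* With A the new first-order coefficient, t^2 v + A = 2 t. Hence t^2 (v' + v^2) + A v = t^2 v' + 2
   t v = l t - N, which accounts for the shifts g - l and e + N. *)
- intros t; rewrite (Cmult_assoc q), <- (Hode (circ t)).
  unfold F, F1, F2, v, v1; assert (Hc := circ_nz t); field; auto.
(* dt contributes a factor t, so the exponent k + 1 of the density drops to k; here d - a is (g - l)
   + l/2. *)
- assert (Hmc : circ_RInt (fun t => F t * (Ci * circ t)) = Ci * moment ell (fun z => P z / z ^ k)).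
  { unfold moment; rewrite <- circ_RInt_scal.
    - apply circ_RInt_ext; intros t; unfold F, w; assert (Hc := circ_nz t).
      assert (Hk := Cpow_nz _ k Hc); cbn [Cpow]; set (u := circ t ^ k) in *; field; auto.
    - apply (moment_cont ell (fun z => P z / z ^ k)), circ_cont_div_pow; exact CP. }
  rewrite Hmc.
  transitivity (Ci * ((g - l / 2) * moment ell (fun z => P z / z ^ k))); [field | rewrite Hm; ring].
- intros u; unfold G; apply (HG P).
Qed.

(** The convention alpha_{-1} = -1 agrees with - Phi_0(0), and realness removes the conjugate, so
    one formula covers all indices. *)
Lemma alpha_pred (ell : R) (Phi : nat -> C -> C) (n : nat) :
  is_monic_OPUC (nu_exp ell) Phi -> alpha Phi (Z.of_nat n - 1) = - Phi n 0.
Proof.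
intros HPhi; unfold alpha; destruct (Z.eqb_spec (Z.of_nat n - 1) (-1)) as [H | H].
- replace n with 0%nat by lia.
  rewrite (is_monic_poly_0 _ (proj1 HPhi 0%nat)); apply C_eq; simpl; ring.
- replace (Z.to_nat (Z.of_nat n - 1 + 1)) with n by lia.
  now rewrite <- (OPUC_real ell Phi n 0 HPhi), Cconj_conj, Cconj_RtoC at 1.
Qed.

Theorem mainTheorem9 (ell : R) (Phi Phis : nat -> C -> C)
  (Hell : (0 < ell)%R)
  (HPhi : is_monic_OPUC (nu_exp ell) Phi)
  (HPhis : is_reversed Phi Phis) :
  (forall k : Z, (-1 <= k)%Z -> Im (alpha Phi k) = 0%R) /\
  forall n : nat, (1 <= n)%nat ->
    let l := RtoC ell in
    let N := RtoC (INR n) in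
    let s := sigma_coef Phi n in
    let an := alpha Phi (Z.of_nat n) in
    let an1 := alpha Phi (Z.of_nat n - 1) in
    let an2 := alpha Phi (Z.of_nat n - 2) in
    let P := Phi n in
    let Q := Phis (n - 1)%nat in
    let G := cauchy_G (nu_exp ell) Phi n in
    let H := cauchy_Gs (nu_exp ell) Phis (n - 1)%nat in
    (forall z : C,
       twice_C_derivable P z /\
       z ^ 2 * C_derive (C_derive P) z
       + (l / 2 * z ^ 2 + (2 - N) * z - l / 2) * C_derive P z
       + (- (l * N / 2) * z - l ^ 2 / 4 - N - l ^ 2 / 4 * s) * P z
       = - (l / 2) * (1 - an1 ^ 2) * an * Q z) /\
    (forall z : C, Cmod z <> 1%R ->
       twice_C_derivable G z /\
       z ^ 2 * C_derive (C_derive G) z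
       + (- (l / 2) * z ^ 2 + (N + 2) * z + l / 2) * C_derive G z
       - (l * (N / 2 + 1) * z + l ^ 2 / 4 + l ^ 2 / 4 * s) * G z
       = - (l / 2) * (1 - an1 ^ 2) * an * H z) /\
    (forall z : C,
       twice_C_derivable Q z /\
       z ^ 2 * C_derive (C_derive Q) z
       + (l / 2 * z ^ 2 + (2 - N) * z - l / 2) * C_derive Q z
       - (l * (N / 2 - 1) * z + l ^ 2 / 4 + l ^ 2 / 4 * s) * Q z
       = - (l / 2) * an2 * P z) /\
    (forall z : C, Cmod z <> 1%R ->
       twice_C_derivable H z /\
       z ^ 2 * C_derive (C_derive H) z
       + (- (l / 2) * z ^ 2 + (N + 2) * z + l / 2) * C_derive H z
       - (l * N / 2 * z + l ^ 2 / 4 - N + l ^ 2 / 4 * s) * H z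
       = - (l / 2) * an2 * G z).
Proof.
split.
- intros k Hk.
  replace k with (Z.of_nat (Z.to_nat (k + 1)) - 1)%Z by lia.
  rewrite (alpha_pred ell) by assumption.
  assert (Hr := f_equal Im (OPUC_real ell Phi (Z.to_nat (k + 1)) 0 HPhi)).
  rewrite Cconj_RtoC in Hr; simpl in Hr |- *; unfold Im in *; lra.
- intros n Hn; destruct n as [ | n]; [lia | clear Hn].
  intros l N s an an1 an2 P Q G H.
  assert (Han : an = - Phi (S (S n)) 0).
  { unfold an; replace (Z.of_nat (S n)) with (Z.of_nat (S (S n)) - 1)%Z by lia.
    now apply (alpha_pred ell). }
  assert (Han1 : an1 = - Phi (S n) 0) by now apply (alpha_pred ell).
  assert (Han2 : an2 = - Phi n 0).
  { unfold an2; replace (Z.of_nat (S n) - 2)%Z with (Z.of_nat n - 1)%Z by lia.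
    now apply (alpha_pred ell). }
  assert (Hs : s = (1 - Phi (S n) 0 ^ 2) * Phi (S (S n)) 0 * Phi n 0 - Phi (S n) 0 ^ 2).
  { transitivity ((1 - an1 ^ 2) * an * an2 - an1 ^ 2); [ | rewrite Han, Han1, Han2; ring].
    unfold s, sigma_coef, an, an1, an2; now rewrite Z.add_0_r. }
  rewrite Han, Han1, Han2, Hs.
  unfold P, Q, H, cauchy_Gs in *; clear P Q H.
  replace (S n - 1)%nat with n in * by lia.
  destruct (OPUC_second_order ell Phi Phis n HPhi HPhis) as [HP HQ].
  fold l N in HP, HQ.
  assert (PP := OPUC_is_poly _ _ (S n) HPhi).
  assert (PQ := is_poly_of_le _ _ (proj1 (HPhis n))).
  split; [ | split; [ | split]].
  + intros z; split; [now apply is_poly_twice | ].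
    transitivity (l / 2 * (1 - Phi (S n) 0 ^ 2) * Phi (S (S n)) 0 * Phis n z); [rewrite <- HP | ]; ring.
  + intros z Hz.
    (* From here the statement's index is [S n], so the exponent [n] is still in the range of
       orthogonality. *)
    assert (Hm := OPUC_ortho_pow ell Phi (S n) n HPhi (le_n _)).
    assert (Hc := Cauchy_ode_of_poly ell _ _ n _ _ _ (/ (2 * RtoC PI * Ci)) PP PQ HP).
    rewrite Hm in Hc; destruct (Hc (Cmult_0_r _) z Hz) as [H1 H2].
    split; [exact H1 | ].
    fold l N in H2.
    etransitivity; [ | etransitivity; [exact H2 | ring]].
    unfold G, cauchy_G; generalize (/ (2 * RtoC PI * Ci)); intros; field.
  + intros z; split; [now apply is_poly_twice | ].
    transitivity (l / 2 * Phi n 0 * Phi (S n) z); [rewrite <- HQ | ]; ring.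
  + intros z Hz.
    assert (Hm : (- (l * (N / 2 - 1)) - l / 2) * moment ell (fun z => Phis n z / z ^ n) = 0).
    (* For [n] = 0 the moment is a nonzero norm, but N = 1 and the coefficient is l/2 - l/2 = 0;
       otherwise reversed orthogonality applies. *)
    { unfold N; destruct n as [ | n]; [simpl; field | ].
      rewrite (reversed_ortho ell Phi Phis) by (auto; lia); ring. }
    destruct (Cauchy_ode_of_poly ell _ _ n _ _ _ (/ (2 * RtoC PI * Ci)) PQ PP HQ Hm z Hz) as [H1 H2].
    split; [exact H1 | ].
    fold l N in H2.
    etransitivity; [ | etransitivity; [exact H2 | unfold G, cauchy_G; ring]].
    generalize (/ (2 * RtoC PI * Ci)); intros; field.
Qed.
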